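(* In non-flat complex space forms $\tilde M^{n+p}(c)$ ($c\ne 0$), there exist no totally umbilical totally real submanifolds $M^n$ with flat normal connection.
   Context: A complex space form $\tilde M^{n+p}(c)$ is a Kähler manifold of complex dimension $n+p$, with complex structure $J$, of constant holomorphic sectional curvature $c$. It is non-flat when $c\neq0$. An $n$-dimensional (real dimension $n$) immersed submanifold $M^n$, with the induced metric and second fundamental form $h$, is totally real if $J(T_xM)\subset T_x^\perp M$ for every $x\in M$. It is totally umbilical if $h(X,Y)=\langle X,Y\rangle\zeta$ for all tangent $X,Y$, where $\zeta=\frac1n\operatorname{trace}h$ is the mean curvature vector (totally geodesic submanifolds are included). The normal connection is flat if the normal curvature tensor $R^\perp$ vanishes identically.
   Formalization: The submanifold M^n is assumed to have dimension n ≥ 2 and to be nonempty; for n = 1 the claim fails, since every regular curve is totally real, totally umbilical and has flat normal connection. *)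

(* Defs.v *)
From mathcomp Require Import all_boot all_order all_algebra.
From mathcomp Require Import all_classical all_reals all_analysis.

Set Implicit Arguments.
Unset Strict Implicit.
Unset Printing Implicit Defensive.

Import Order.TTheory GRing.Theory Num.Theory.
Import numFieldNormedType.Exports.

Local Open Scope classical_set_scope.
Local Open Scope ring_scope.

(** Conventions.  Points of R^m and tangent vectors are row vectors, and a
    matrix A acts on a row vector v as [v *m A].  Tensor fields on a manifold
    are given by their components in the charts, subject to the tensorial
    change-of-coordinates rule; all the conditions below are required in every
    chart. *)

Section Smooth.
Context {R : realType}.

Definition iter_derive {V W : normedModType R} (vs : seq V) (f : V -> W) :
  V -> W := foldr (fun v g x => 'D_v g x) f vs.

(* C^oo on an open set A: the iterated directional derivatives of every order
   are differentiable (in particular continuous) at every point of A. *)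
Definition smooth_on {V W : normedModType R} (A : set V) (f : V -> W) : Prop :=
  forall (vs : seq V) (x : V), A x -> differentiable (iter_derive vs f) x.

End Smooth.

Record manifold (R : realType) (m : nat) := Manifold {
  carrier :> topologicalType;
  man_hausdorff : hausdorff_space carrier;
  man_second_countable : @second_countable carrier;
  chart : Type;
  dom : chart -> set carrier;
  coord : chart -> carrier -> 'rV[R]_m;
  (* the inverse of the coordinate map, with arbitrary values outside of the
     image of the chart domain *)
  param : chart -> 'rV[R]_m -> carrier;
  dom_open : forall a, open (dom a);
  dom_cover : forall x, exists a, dom a x;
  coordK : forall a x, dom a x -> param a (coord a x) = x;
  coord_open : forall a, open (coord a @` dom a);
  coord_continuous : forall a x, dom a x -> {for x, continuous (coord a)};
  param_continuous : forall a u, (coord a @` dom a) u ->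
    {for u, continuous (param a)};
  transition_smooth : forall a b,
    smooth_on (coord a @` (dom a `&` dom b)) (coord b \o param a)
}.

Section Local.
Context {R : realType}.

Definition inner {m : nat} (G : 'M[R]_m) (v w : 'rV[R]_m) : R :=
  (v *m G *m w^T) 0 0.

(** Riemannian geometry in one chart; [g] is the matrix of the metric as a
    function of the coordinates. *)
Section Riemannian.
Context {m : nat}.
Implicit Types (g : 'rV[R]_m -> 'M[R]_m) (X Y Z : 'rV[R]_m -> 'rV[R]_m).

(* [christoffel g x v w] is the vector z^k = Gamma^k_ij(x) v^i w^j of the
   Levi-Civita connection:
   2 <z, e_k> = (D_v g)(w, e_k) + (D_w g)(v, e_k) - (D_k g)(v, w). *)
Definition christoffel g (x v w : 'rV[R]_m) : 'rV[R]_m :=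
  (\row_k (2^-1 * (inner ('D_v g x) w (delta_mx 0 k)
                 + inner ('D_w g x) v (delta_mx 0 k)
                 - inner ('D_(delta_mx 0 k) g x) v w))) *m invmx (g x).

Definition nabla g X Y : 'rV[R]_m -> 'rV[R]_m :=
  fun x => 'D_(X x) Y x + christoffel g x (X x) (Y x).

Definition lie_bracket X Y : 'rV[R]_m -> 'rV[R]_m :=
  fun x => 'D_(X x) Y x - 'D_(Y x) X x.

Definition curvature g X Y Z : 'rV[R]_m -> 'rV[R]_m :=
  fun x => nabla g X (nabla g Y Z) x - nabla g Y (nabla g X Z) x
           - nabla g (lie_bracket X Y) Z x.

(* The curvature is a tensor, so its value on tangent vectors is computed by
   extending them with constant components. *)
Definition sectional_curvature g (x v w : 'rV[R]_m) : R :=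
  inner (g x) (curvature g (cst v) (cst w) (cst w) x) v
  / (inner (g x) v v * inner (g x) w w - inner (g x) v w ^+ 2).

End Riemannian.

(** Geometry of an immersion, in one chart of the submanifold and one chart of
    the ambient manifold; [F] is the coordinate expression of the immersion and
    [g] the ambient metric. *)
Section Immersion.
Context {n m : nat} (g : 'rV[R]_m -> 'M[R]_m) (F : 'rV[R]_n -> 'rV[R]_m).
Implicit Types (X Y : 'rV[R]_n -> 'rV[R]_n) (xi : 'rV[R]_n -> 'rV[R]_m).

Definition induced_metric (u : 'rV[R]_n) : 'M[R]_n :=
  'J F u *m g (F u) *m ('J F u)^T.

(* g^ij <w, F_i> F_j, with g^ij the inverse of the induced metric *)
Definition tangent_part (u : 'rV[R]_n) (w : 'rV[R]_m) : 'rV[R]_m :=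
  w *m g (F u) *m ('J F u)^T *m invmx (induced_metric u) *m 'J F u.

Definition normal_part (u : 'rV[R]_n) (w : 'rV[R]_m) : 'rV[R]_m :=
  w - tangent_part u w.

Definition is_normal (u : 'rV[R]_n) (w : 'rV[R]_m) : Prop :=
  forall v : 'rV[R]_n, inner (g (F u)) ('d F u v) w = 0.

(* the ambient Levi-Civita connection acting on vector fields along F *)
Definition nabla_along X xi : 'rV[R]_n -> 'rV[R]_m :=
  fun u => 'D_(X u) xi u + christoffel g (F u) ('d F u (X u)) (xi u).

(* h(v, w) is the normal part of the ambient derivative of F_* w along v; it
   is tensorial, hence computed by extending v and w with constant
   components. *)
Definition second_fundamental_form (u v w : 'rV[R]_n) : 'rV[R]_m :=
  normal_part u (nabla_along (cst v) (fun u' => 'd F u' w) u).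

Definition mean_curvature (u : 'rV[R]_n) : 'rV[R]_m :=
  n%:R^-1 *: \sum_(i < n) \sum_(j < n)
    (invmx (induced_metric u) i j *:
       second_fundamental_form u (delta_mx 0 i) (delta_mx 0 j)).

Definition normal_nabla X xi : 'rV[R]_n -> 'rV[R]_m :=
  fun u => normal_part u (nabla_along X xi u).

Definition normal_curvature X Y xi : 'rV[R]_n -> 'rV[R]_m :=
  fun u => normal_nabla X (normal_nabla Y xi) u
           - normal_nabla Y (normal_nabla X xi) u
           - normal_nabla (lie_bracket X Y) xi u.

End Immersion.
End Local.

Definition coord_image (R : realType) (m : nat) (M : manifold R m)
  (a : chart M) : set 'rV[R]_m := coord a @` dom a.

(* the Jacobian matrix at x of the change of coordinates from a to b *)
Definition transition_mx (R : realType) (m : nat) (M : manifold R m)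
  (a b : chart M) (x : M) : 'M[R]_m := 'J (coord b \o param a) (coord a x).

Record riemannian_metric (R : realType) (m : nat) (M : manifold R m) :=
  RiemannianMetric {
  metric_mx :> chart M -> 'rV[R]_m -> 'M[R]_m;
  metric_smooth : forall a, smooth_on (coord_image a) (metric_mx a);
  metric_sym : forall a u, coord_image a u -> (metric_mx a u)^T = metric_mx a u;
  metric_pos : forall a u v, coord_image a u -> v != 0 ->
    0 < inner (metric_mx a u) v v;
  metric_transition : forall a b x, dom a x -> dom b x ->
    metric_mx a (coord a x) =
    transition_mx a b x *m metric_mx b (coord b x) *m (transition_mx a b x)^T
}.

(** Kaehler manifolds: almost Hermitian manifolds with parallel J. *)
Record kaehler_manifold (R : realType) (k : nat) := KaehlerManifold {
  kaehler_man :> manifold R (2 * k);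
  kaehler_metric : riemannian_metric kaehler_man;
  cpx : chart kaehler_man -> 'rV[R]_(2 * k) -> 'M[R]_(2 * k);
  cpx_smooth : forall a, smooth_on (coord_image a) (cpx a);
  cpx_transition : forall a b x, dom a x -> dom b x ->
    cpx a (coord a x) *m transition_mx a b x =
    transition_mx a b x *m cpx b (coord b x);
  cpx_square : forall a u, coord_image a u -> cpx a u *m cpx a u = - 1%:M;
  cpx_isometry : forall a u v w, coord_image a u ->
    inner (kaehler_metric a u) (v *m cpx a u) (w *m cpx a u) =
    inner (kaehler_metric a u) v w;
  cpx_parallel : forall a (X Y : 'rV[R]_(2 * k) -> 'rV[R]_(2 * k)),
    smooth_on (coord_image a) X -> smooth_on (coord_image a) Y ->
    forall u, coord_image a u ->
      nabla (kaehler_metric a) X (fun x => Y x *m cpx a x) u =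
      nabla (kaehler_metric a) X Y u *m cpx a u
}.

Definition complex_space_form (R : realType) (k : nat)
  (N : kaehler_manifold R k) (c : R) : Prop :=
  forall (a : chart N) u v, coord_image a u -> v != 0 ->
    sectional_curvature (kaehler_metric N a) u v (v *m cpx a u) = c.

Section Submanifold.
Context {R : realType}.

Section Maps.
Context {n m : nat} {M : manifold R n} {N : manifold R m} (f : M -> N).

Definition local_dom (a : chart M) (b : chart N) : set 'rV[R]_n :=
  coord a @` (dom a `&` f @^-1` dom b).

Definition local_expr (a : chart M) (b : chart N) : 'rV[R]_n -> 'rV[R]_m :=
  coord b \o f \o param a.

Definition smooth_map : Prop :=
  continuous f /\ forall a b, smooth_on (local_dom a b) (local_expr a b).

Definition immersion : Prop :=
  smooth_map /\ forall a b u, local_dom a b u ->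
    injective ('d (local_expr a b) u).

Definition totally_umbilical (g : riemannian_metric N) : Prop :=
  forall a b u v w, local_dom a b u ->
    second_fundamental_form (g b) (local_expr a b) u v w =
    inner (induced_metric (g b) (local_expr a b) u) v w *:
      mean_curvature (g b) (local_expr a b) u.

Definition flat_normal_connection (g : riemannian_metric N) : Prop :=
  forall a b (O : set 'rV[R]_n), open O -> O `<=` local_dom a b ->
  forall (X Y : 'rV[R]_n -> 'rV[R]_n) (xi : 'rV[R]_n -> 'rV[R]_m),
    smooth_on O X -> smooth_on O Y -> smooth_on O xi ->
    (forall u, O u -> is_normal (g b) (local_expr a b) u (xi u)) ->
  forall u, O u -> normal_curvature (g b) (local_expr a b) X Y xi u = 0.

End Maps.

Definition totally_real {n k : nat} {M : manifold R n}
  {N : kaehler_manifold R k} (f : M -> N) : Prop :=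
  forall a b u v, local_dom f a b u ->
    is_normal (kaehler_metric N b) (local_expr f a b) u
      ('d (local_expr f a b) u v *m cpx b (local_expr f a b u)).

End Submanifold.

(* Main.v *)
From HB Require Import structures.
Require Import Defs.
From mathcomp Require Import all_boot all_order all_algebra.
From mathcomp Require Import all_classical all_reals all_analysis.
From mathcomp Require Import ring lra.

Set Implicit Arguments.
Unset Strict Implicit.
Unset Printing Implicit Defensive.

Import Order.TTheory GRing.Theory Num.Theory.
Import numFieldNormedType.Exports.

Local Open Scope classical_set_scope.
Local Open Scope ring_scope.

(** For a tangent vector field Z, J Z is normal.  On a totally umbilical
    submanifold the shape operators are multiples of the identity, so they
    commute, and by the Ricci equation a flat normal connection gives
    <R(X, Y) J Y, J X> = 0 for the ambient curvature R and all tangent X, Y.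
    Since J is parallel this is <R(X, Y) Y, X>, which by polarization of the
    constancy of the holomorphic sectional curvature equals
    c / 4 (|X|^2 |Y|^2 - <X, Y>^2) on a totally real plane.  Hence c = 0. *)

(** * Calculus of matrix-valued functions *)

(** The mean curvature vector H enters the second normal derivative of J Z, and the proof is
    arranged so that no derivative of H has to be computed. For constant z, the ambient derivative
    along w of the normal field J F_* z has tangent part -a F_* w with a = <J F_* z, H>, so its
    normal derivative is the ambient derivative plus the tangent field a F_* w. Pairing the second
    normal derivative along v with another normal field J F_* z' moves the outer derivative off a
    F_* w by orthogonality. What remains is a a' <v, w>, which is symmetric in v and w and drops out
    of the commutator. Tangent fields are taken with constant components. Their brackets vanish, and
    the symmetry of second partial derivatives turns commutators of covariant derivatives into the
    curvature tensor. *)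

Section MatrixCalculus.
Context {R : realType} {V : normedModType R}.

Lemma differentiable_entry m n (f : V -> 'M[R]_(m, n)) x i j :
  differentiable f x -> differentiable (fun y => f y i j) x.
Proof.
move=> df; exact: (differentiable_comp df (differentiable_coord _ _ _)).
Qed.

Lemma differentiable_fun_sum (W : normedModType R) (I : Type) (r : seq I)
    (P : pred I) (f : I -> V -> W) x :
  (forall i, P i -> differentiable (f i) x) ->
  differentiable (fun y => \sum_(i <- r | P i) f i y) x.
Proof.
move=> df; rewrite -fct_sumE.
by elim/big_ind : _ => // *; exact: differentiableD.
Qed.

Lemma differentiable_fun_prod (I : Type) (r : seq I)
    (P : pred I) (f : I -> V -> R) x :
  (forall i, P i -> differentiable (f i) x) ->
  differentiable (fun y => \prod_(i <- r | P i) f i y) x.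
Proof.
move=> df; elim: r => [|i r ih].
  rewrite (_ : (fun _ => _) = cst 1)//; apply/funext => y /=.
  by rewrite big_nil.
rewrite (_ : (fun _ => _) = fun y => (if P i then f i y else 1) *
  \prod_(i <- r | P i) f i y).
  apply: differentiableM => //; case E : (P i); first exact: df.
  exact: differentiable_cst.
apply/funext => y; rewrite big_cons; case: ifP => //; by rewrite mul1r.
Qed.

Lemma differentiable_mx m n (f : V -> 'M[R]_(m, n)) x :
  (forall i j, differentiable (fun y => f y i j) x) -> differentiable f x.
Proof.
move=> df; rewrite (_ : f = fun y => \sum_i \sum_j f y i j *: delta_mx i j).
  do 2 (apply: differentiable_fun_sum => ? _).
  by apply: differentiableZl.
by apply/funext => y; rewrite -matrix_sum_delta.
Qed.

Lemma derive_entry m n (f : V -> 'M[R]_(m, n)) x v i j : differentiable f x ->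
  'D_v (fun y => f y i j) x = 'D_v f x i j.
Proof. by move=> df; rewrite [in RHS]derive_mx ?mxE//; exact: diff_derivable. Qed.

Lemma differentiable_mulmx m n p (f : V -> 'M[R]_(m, n))
    (g : V -> 'M[R]_(n, p)) x :
  differentiable f x -> differentiable g x ->
  differentiable (fun y => f y *m g y) x.
Proof.
move=> df dg; apply: differentiable_mx => i j.
under eq_fun do rewrite mxE.
apply: differentiable_fun_sum => k _.
by apply: differentiableM; exact: differentiable_entry.
Qed.

Lemma derive_fun_sum (W : normedModType R) (I : Type) (r : seq I)
    (P : pred I) (f : I -> V -> W) x v :
  (forall i, P i -> differentiable (f i) x) ->
  'D_v (fun y => \sum_(i <- r | P i) f i y) x =
  \sum_(i <- r | P i) 'D_v (f i) x.
Proof.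
move=> df; rewrite -fct_sumE.
suff [_] : differentiable (\sum_(i <- r | P i) f i) x /\
  'D_v (\sum_(i <- r | P i) f i) x = \sum_(i <- r | P i) 'D_v (f i) x by [].
elim/big_ind2 : _ => [|g a h b [dg <-] [dh <-]|i /df ?]; last by [].
  by split; [exact: differentiable_cst|exact: derive_cst].
split; first exact: differentiableD.
by rewrite deriveD//; exact: diff_derivable.
Qed.

Lemma derive_mulmx m n p (f : V -> 'M[R]_(m, n))
    (g : V -> 'M[R]_(n, p)) x v :
  differentiable f x -> differentiable g x ->
  'D_v (fun y => f y *m g y) x = 'D_v f x *m g x + f x *m 'D_v g x.
Proof.
move=> df dg; apply/matrixP => i j.
rewrite -derive_entry; last exact: differentiable_mulmx.
under eq_fun do rewrite mxE.
rewrite derive_fun_sum => [|k _]; last first.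
  by apply: differentiableM; exact: differentiable_entry.
rewrite !mxE -big_split/=; apply: eq_bigr => k _.
rewrite (deriveM (f := fun y => f y i k) (g := fun y => g y k j)).
- rewrite !derive_entry// /GRing.scale/= addrC; congr (_ + _); exact: mulrC.
- exact/diff_derivable/differentiable_entry.
- exact/diff_derivable/differentiable_entry.
Qed.

Lemma differentiable_trmx m n (f : V -> 'M[R]_(m, n)) x :
  differentiable f x -> differentiable (fun y => (f y)^T) x.
Proof.
move=> df; apply: differentiable_mx => i j.
under eq_fun do rewrite mxE; exact: differentiable_entry.
Qed.

Lemma derive_trmx m n (f : V -> 'M[R]_(m, n)) x v : differentiable f x ->
  'D_v (fun y => (f y)^T) x = ('D_v f x)^T.
Proof.
move=> df; apply/matrixP => i j.
rewrite -derive_entry; last exact: differentiable_trmx.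
under eq_fun do rewrite mxE.
by rewrite derive_entry// mxE.
Qed.

Lemma differentiable_det n (f : V -> 'M[R]_n) x :
  differentiable f x -> differentiable (fun y => \det (f y)) x.
Proof.
move=> df; apply: differentiable_fun_sum => s _.
apply: differentiableM => //; apply: differentiable_fun_prod => i _.
exact: differentiable_entry.
Qed.

(** The first-order expansion of [f] at [x] depends only on its germ, so it is also one for [g].
    Uniqueness of the differential then identifies ['d g x] with ['d f x]. *)
Lemma differentiable_near_eq (W : normedModType R) (f g : V -> W) x :
  (\forall y \near x, f y = g y) -> differentiable f x -> differentiable g x.
Proof.
move=> fg df.
have gE : g \o shift x = cst (g x) + 'd f x +o_ 0 id.
  apply/eqaddoP => _/posnumP[e]; have := diff_locally df.
  move=> /eqaddoP /(_ e%:num) /(_ [gt0 of e%:num]).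
  rewrite -(nbhs_singleton fg); apply: filter_app.
  have : \forall h \near 0, f (h + x) = g (h + x).
    by move: fg; rewrite (near_shift 0) subr0.
  apply: filterS => h fgh.
  rewrite (_ : (g \o shift x - _) h =
    (f \o shift x - (cst (f x) + 'd f x)) h)//.
  by rewrite -[LHS]/(g (h + x) - (cst (f x) + 'd f x) h) -fgh.
have dgE : 'd g x = 'd f x :> (V -> W).
  by apply: diff_unique gE; exact: diff_continuous.
apply/diff_locallyP; rewrite dgE; split => //; exact: diff_continuous.
Qed.

(** Cramer's formula makes the inverse rational in the entries. It describes [invmx] only where the
    determinant is nonzero, which continuity guarantees near [x]. *)
Lemma differentiable_invmx n (f : V -> 'M[R]_n) x :
  differentiable f x -> f x \in unitmx ->
  differentiable (fun y => invmx (f y)) x.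
Proof.
move=> df fx.
have dd := differentiable_det df.
have fx0 : \det (f x) != 0 by rewrite -unitfE.
have ndet : \forall y \near x, \det (f y) != 0.
  exact: (cvgr_neq0 _ (differentiable_continuous dd) fx0).
apply: (@differentiable_near_eq _ (fun y => (\det (f y))^-1 *: \adj (f y))).
  near=> y; rewrite /invmx ifT// unitmxE unitfE; by near: y.
apply: differentiable_mx => i j.
under eq_fun do rewrite mxE.
apply: differentiableM; first exact: differentiableV.
under eq_fun do rewrite mxE.
apply: differentiableM => //; apply: differentiable_det.
apply: differentiable_mx => k l.
under eq_fun do rewrite !mxE.
exact: differentiable_entry.
Unshelve. all: by end_near. Qed.

Lemma derive_near_eq (W : normedModType R) (f g : V -> W) (A : set V) x v :
  open A -> (forall y, A y -> f y = g y) -> A x -> 'D_v f x = 'D_v g x.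
Proof.
move=> oA fg Ax; apply: near_eq_derive; near=> y; apply: fg.
by near: y; exact: open_nbhs_nbhs.
Unshelve. all: by end_near. Qed.

End MatrixCalculus.

(** * Symmetry of second derivatives *)

Section Schwarz.
Context {R : realType} {V : normedModType R}.

Lemma MVT_closed (phi dphi : R -> R) (h : R) : 0 <= h ->
  (forall s : R, s \in `[0, h] -> is_derive s 1 phi (dphi s)) ->
  exists2 c : R, c \in `[0, h] & phi h - phi 0 = dphi c * h.
Proof.
move=> h0 dphiP.
have dphi_oo (s : R) : s \in `]0, h[ -> is_derive s 1 phi (dphi s).
  by move=> sh; apply: dphiP; exact: subset_itv_oo_cc.
have phi_cont : {within `[0, h], continuous phi}.
  by apply: derivable_within_continuous => s /dphiP[].
have [c ch E] := MVT_segment h0 dphi_oo phi_cont.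
by exists c => //; rewrite E subr0.
Qed.

(* The mean value theorem in the direction [v] expresses the second difference
   of [f] as the increment of ['D_v f] between two points at distance [h w]. *)
Lemma second_difference (f : V -> R) (x v w : V) :
  (\forall y \near x, differentiable f y) -> differentiable ('D_v f) x ->
  forall e : R, 0 < e -> \forall h \near 0^'+,
    `|f (x + h *: v + h *: w) - f (x + h *: v) - f (x + h *: w) + f x
      - h ^+ 2 * 'D_w ('D_v f) x| <= e * h ^+ 2.
Proof.
move=> df dvf e e0.
(* The expansion of ['D_v f] is used at the increments c v + h w and c v with c in [0, h], whose
   norms add up to at most h (2 |v| + |w|). The summand 1 makes [k] positive. *)
pose k := 2 * `|v| + `|w| + 1.
have k0 : 0 < k by rewrite ltr_wpDl// addr_ge0// mulr_ge0.
have /nbhs_ballP[r1/= r10 B1] := df.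
have := diff_locally dvf => /eqaddoP /(_ (e / k) (divr_gt0 e0 k0)).
move=> /nbhs_ballP[r2/= r20 B2].
near=> h.
have h0 : 0 < h by near: h; exact: nbhs_right_gt.
have hk1 : h * k < r1.
  by rewrite -ltr_pdivlMr//; near: h; apply: nbhs_right_lt; rewrite divr_gt0.
have hk2 : h * k < r2.
  by rewrite -ltr_pdivlMr//; near: h; apply: nbhs_right_lt; rewrite divr_gt0.
have small (s t : R) : s \in `[0, h] -> 0 <= t <= h ->
    `|s *: v + t *: w| <= h * (`|v| + `|w|).
  rewrite in_itv/= => /andP[s0 sh] /andP[t0 th].
  rewrite (le_trans (ler_normD _ _))// !normrZ !ger0_norm// mulrDr lerD//.
    by rewrite ler_wpM2r.
  by rewrite ler_wpM2r.
have smallk (s t : R) : s \in `[0, h] -> 0 <= t <= h -> `|s *: v + t *: w| < h * k.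
  move=> sh th; rewrite (le_lt_trans (small _ _ sh th))//.
  rewrite ltr_pM2l// /k; have := normr_ge0 v; have := normr_ge0 w; lra.
pose phi (s : R) : R := f (x + s *: v + h *: w) - f (x + s *: v).
pose dphi (s : R) : R := 'D_v f (x + s *: v + h *: w) - 'D_v f (x + s *: v).
have hh : 0 <= h <= h by rewrite lexx ltW.
have h00 : (0 : R) <= 0 <= h by rewrite lexx ltW.
have line (s t : R) : s \in `[0, h] -> 0 <= t <= h ->
    is_derive s 1 (fun s => f (x + s *: v + t *: w))
      ('D_v f (x + s *: v + t *: w)).
  move=> sh th.
  have dfs : differentiable f (x + s *: v + t *: w).
    apply: B1; rewrite -ball_normE/= opprD addrA opprD addrA subrr add0r.
    by rewrite -opprD normrN (lt_trans (smallk _ _ sh th)).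
  pose l s := x + s *: v + t *: w.
  have lE : (fun r : R => r^-1 *: (((f \o l) \o shift s) (r *: 1) - f (l s))) =
      fun r => r^-1 *: ((f \o shift (l s)) (r *: v) - f (l s)).
    apply/funext => r /=; congr (_ *: (f _ - _)).
    by rewrite /l [r *: 1]mulr1 scalerDl [RHS]addrC -!addrA [r *: v + _]addrCA
      [r *: v + _]addrC.
  have := diff_derivable (v := v) dfs; rewrite /derivable -[x + _ + _]/(l s) -lE => dfl.
  by apply: DeriveDef => //; rewrite /derive -[in RHS]/(l s) -lE.
have dphiP (s : R) : s \in `[0, h] -> is_derive s 1 phi (dphi s).
  move=> sh; apply: is_deriveB; first exact: line.
  by have := line s 0 sh h00; under eq_fun do rewrite scale0r addr0;
    rewrite scale0r addr0.
have [c ch] := MVT_closed (ltW h0) dphiP.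
rewrite /phi !scale0r addr0 => E.
have G y : `|y| < h * k ->
    `|'D_v f (y + x) - 'D_v f x - 'D_y ('D_v f) x| <= e / k * `|y|.
  move=> yk; have := B2 y; rewrite -ball_normE/= sub0r normrN.
  move=> /(_ (lt_trans yk hk2)).
  rewrite -[X in `|X| <= _]/('D_v f (y + x) - ('D_v f x + 'd ('D_v f) x y)).
  by rewrite (deriveE y dvf) opprD addrA.
have -> : f (x + h *: v + h *: w) - f (x + h *: v) - f (x + h *: w) + f x
   - h ^+ 2 * 'D_w ('D_v f) x = h * (dphi c - h * 'D_w ('D_v f) x).
  rewrite mulrBr [h * dphi c]mulrC -E; ring.
rewrite normrM (gtr0_norm h0) expr2 mulrCA ler_pM2l//.
have ch' : 0 <= h <= h by [].
have := G _ (smallk _ _ ch hh); have := G _ (smallk _ _ ch h00).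
rewrite scale0r addr0.
have DE s t : 'D_(s *: v + t *: w) ('D_v f) x =
    s * 'D_v ('D_v f) x + t * 'D_w ('D_v f) x.
  by rewrite !deriveE// linearD !linearZ.
have DcE : 'D_(c *: v) ('D_v f) x = c * 'D_v ('D_v f) x.
  by rewrite !deriveE// linearZ.
rewrite DE DcE => H1 H2.
have -> : dphi c = 'D_v f (c *: v + h *: w + x) - 'D_v f (c *: v + x).
  by rewrite /dphi [c *: v + h *: w + x]addrC addrA [c *: v + x]addrC.
move: ('D_v f (c *: v + h *: w + x)) ('D_v f (c *: v + x))
  ('D_v ('D_v f) x) ('D_w ('D_v f) x) ('D_v f x) H1 H2 => a b p q r H1 H2.
(* Both first-order expansions contain c p, so the unknown intermediate point c disappears from the
   main term. *)
have -> : a - b - h * q = (a - r - (c * p + h * q)) - (b - r - c * p) by ring.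
rewrite (le_trans (ler_normB _ _))// (le_trans (lerD H2 H1))//.
rewrite -mulrDr mulrAC ler_pdivrMr// -mulrA ler_pM2l//.
have := small _ _ ch hh; have := small _ _ ch h00; rewrite scale0r addr0 /k.
have n1 : `|c *: v| <= h * `|v|.
  rewrite normrZ ler_wpM2r//; move: ch; rewrite in_itv/= => /andP[c0 ch].
  by rewrite ger0_norm.
move: `|c *: v + h *: w| `|c *: v| `|v| `|w| n1 => s1 s2 s3 s4.
clear -h0; nra.
Unshelve. all: by end_near. Qed.

(** The second difference is symmetric in [v] and [w], and for small h it lies within e/2 h^2 of h^2
    times either mixed derivative. *)
Lemma schwarz (f : V -> R) (x v w : V) :
  (\forall y \near x, differentiable f y) ->
  differentiable ('D_v f) x -> differentiable ('D_w f) x ->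
  'D_v ('D_w f) x = 'D_w ('D_v f) x.
Proof.
move=> df dvf dwf; apply/eqP; rewrite -subr_eq0 -normr_le0.
apply/ler_addgt0Pl => e e0; rewrite addr0.
have e20 : 0 < e / 2 by rewrite divr_gt0.
have S1 := @second_difference f x v w df dvf _ e20.
have S2 := @second_difference f x w v df dwf _ e20.
move: ('D_w ('D_v f) x) ('D_v ('D_w f) x) S1 S2 => a1 a2 S1 S2.
have [h [h0 h1 h2]] : exists h : R, [/\ 0 < h,
   `|f (x + h *: v + h *: w) - f (x + h *: v) - f (x + h *: w) + f x
      - h ^+ 2 * a1| <= e / 2 * h ^+ 2 &
   `|f (x + h *: w + h *: v) - f (x + h *: w) - f (x + h *: v) + f x
      - h ^+ 2 * a2| <= e / 2 * h ^+ 2].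
  apply: (@filter_ex _ (0^'+ : set_system R)); near=> h; split.
  - by near: h; exact: nbhs_right_gt.
  - by near: h; exact: S1.
  - by near: h; exact: S2.
have hh : 0 < h ^+ 2 by rewrite exprn_gt0.
rewrite -(ler_pM2l hh) -[X in X * _](gtr0_norm hh) -normrM.
move: h1 h2; rewrite [x + h *: w + _]addrAC.
set D := f _; set a := f _; set b := f _; set c := f x => h1 h2.
rewrite (_ : h ^+ 2 * _ = (D - a - b + c - h ^+ 2 * a1)
  - (D - b - a + c - h ^+ 2 * a2)); last by ring.
rewrite (le_trans (ler_normB _ _))// (le_trans (lerD h1 h2))//.
by rewrite -mulrDl -splitr mulrC.
Unshelve. all: by end_near. Qed.

End Schwarz.

(** * Stability of smoothness under products and composition *)

Section SmoothCalculus.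
Context {R : realType}.

(** Smoothness graded by order. Induction on [k] handles the product and chain rules directly,
    whereas a fixed list of directions would have to be distributed over the factors. *)
Fixpoint Ck {V W : normedModType R} (k : nat) (A : set V) (f : V -> W) : Prop :=
  (forall x, A x -> differentiable f x) /\
  (if k is k'.+1 then forall v, Ck k' A (fun x => 'D_v f x) else True).

Lemma smooth_on_derive {V W : normedModType R} (A : set V) (f : V -> W) v :
  smooth_on A f -> smooth_on A (fun x => 'D_v f x).
Proof.
move=> sf vs x Ax; have := sf (rcons vs v) x Ax.
by rewrite /iter_derive foldr_rcons.
Qed.

Lemma smooth_on_diff {V W : normedModType R} (A : set V) (f : V -> W) x :
  smooth_on A f -> A x -> differentiable f x.
Proof. by move=> sf Ax; exact: (sf [::]). Qed.

Lemma smooth_onP {V W : normedModType R} (A : set V) (f : V -> W) :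
  smooth_on A f <-> forall k, Ck k A f.
Proof.
split=> [sf k|].
  elim: k f sf => [|k ih] f sf /=; split=> //.
  - by move=> x; exact: smooth_on_diff.
  - by move=> x; exact: smooth_on_diff.
  - by move=> v; apply: ih; exact: smooth_on_derive.
(* [foldr] applies the last direction first, so removing it from the list replaces [f] by its
   derivative. *)
move=> Cf vs; elim/last_ind: vs f Cf => [|vs v ih] f Cf x Ax.
  by have [df _] := Cf 0%N; exact: df.
rewrite /iter_derive foldr_rcons; apply: ih => // k.
by have [_] := Cf k.+1; apply.
Qed.

Lemma Ck_diff {V W : normedModType R} k (A : set V) (f : V -> W) x :
  Ck k A f -> A x -> differentiable f x.
Proof. by case: k => [|k] [df _]; exact: df. Qed.

Lemma CkW {V W : normedModType R} k (A : set V) (f : V -> W) :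
  Ck k.+1 A f -> Ck k A f.
Proof.
elim: k f => [|k ih] f [df dvf]; split=> // v.
by apply: ih; exact: dvf.
Qed.

(** Derivation rules hold only at points of [A]. Since [A] is open, agreement on [A] is agreement of
    germs and passes to all derivatives. *)
Lemma Ck_eq {V W : normedModType R} k (A : set V) (f g : V -> W) :
  open A -> (forall x, A x -> f x = g x) -> Ck k A f -> Ck k A g.
Proof.
move=> oA; elim: k f g => [|k ih] f g fg [df dvf].
  split=> // x Ax; apply: differentiable_near_eq (df _ Ax).
  by near=> y; apply: fg; near: y; exact: open_nbhs_nbhs.
split=> [x Ax|v].
  apply: differentiable_near_eq (df _ Ax).
  by near=> y; apply: fg; near: y; exact: open_nbhs_nbhs.
by apply: ih (dvf v) => x Ax; exact: (derive_near_eq _ oA fg).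
Unshelve. all: by end_near. Qed.

Lemma Ck_cst {V W : normedModType R} k (A : set V) (a : W) :
  Ck k A (fun=> a).
Proof.
elim: k a => [|k ih] a; split=> // v.
rewrite (_ : (fun x => 'D_v (fun=> a) x) = fun=> 0)//.
by apply/funext => x; exact: derive_cst.
Qed.

Lemma Ck_add {V W : normedModType R} k (A : set V) (f g : V -> W) : open A ->
  Ck k A f -> Ck k A g -> Ck k A (fun x => f x + g x).
Proof.
move=> oA; elim: k f g => [|k ih] f g Cf Cg.
  by split=> // x Ax; apply: differentiableD; [exact: (Ck_diff Cf)|
    exact: (Ck_diff Cg)].
split=> [x Ax|v].
  by apply: differentiableD; [exact: (Ck_diff Cf)|exact: (Ck_diff Cg)].
apply: (Ck_eq oA _ (ih _ _ (Cf.2 v) (Cg.2 v))) => x Ax.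
by rewrite deriveD//; apply: diff_derivable;
  [exact: (Ck_diff Cf)|exact: (Ck_diff Cg)].
Qed.

Lemma Ck_sum {V W : normedModType R} k (A : set V) (I : Type) (r : seq I)
    (f : I -> V -> W) : open A ->
  (forall i, Ck k A (f i)) -> Ck k A (fun x => \sum_(i <- r) f i x).
Proof.
move=> oA Cf; elim: r => [|i r ih].
  by apply: (Ck_eq oA _ (Ck_cst k A 0)) => x _; rewrite big_nil.
by apply: (Ck_eq oA _ (Ck_add oA (Cf i) ih)) => x _; rewrite big_cons.
Qed.

Lemma Ck_mul {V : normedModType R} k (A : set V) (f g : V -> R) : open A ->
  Ck k A f -> Ck k A g -> Ck k A (fun x => f x * g x).
Proof.
move=> oA; elim: k f g => [|k ih] f g Cf Cg.
  by split=> // x Ax; apply: differentiableM; [exact: (Ck_diff Cf)|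
    exact: (Ck_diff Cg)].
split=> [x Ax|v].
  by apply: differentiableM; [exact: (Ck_diff Cf)|exact: (Ck_diff Cg)].
have := Ck_add oA (ih _ _ (CkW Cf) (Cg.2 v)) (ih _ _ (CkW Cg) (Cf.2 v)).
apply: (Ck_eq oA) => x Ax.
by rewrite deriveM//; apply: diff_derivable;
  [exact: (Ck_diff Cf)|exact: (Ck_diff Cg)].
Qed.

Lemma Ck_mxP {V : normedModType R} m n k (A : set V) (f : V -> 'M[R]_(m, n)) :
  open A -> Ck k A f <-> forall i j, Ck k A (fun x => f x i j).
Proof.
move=> oA; elim: k f => [|k ih] f; split.
- by move=> [df _] i j; split=> // x Ax; apply: differentiable_entry; exact: df.
- by move=> df; split=> // x Ax; apply: differentiable_mx => i j;
    exact: (Ck_diff (df i j)).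
- move=> Cf i j; split=> [x Ax|v].
    by apply: differentiable_entry; exact: (Ck_diff Cf).
  have /ih/(_ i j) := Cf.2 v; apply: (Ck_eq oA) => x Ax.
  by rewrite derive_entry//; exact: (Ck_diff Cf).
- move=> Cf.
  have df x : A x -> differentiable f x.
    by move=> Ax; apply: differentiable_mx => i j; exact: (Ck_diff (Cf i j)).
  split=> // v; apply/ih => i j; apply: (Ck_eq oA _ ((Cf i j).2 v)) => x Ax.
  by rewrite derive_entry//; exact: df.
Qed.

(** In 'd h (F x) ('D_v F x) the direction varies with [x]. Expanding it over fixed directions gives
    sums of products, to which the induction in [Ck_comp] applies. *)
Lemma derive_comp_coord {V : normedModType R} m (h : 'rV[R]_m -> R)
    (F : V -> 'rV[R]_m) x v :
  differentiable F x -> differentiable h (F x) ->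
  'D_v (fun y => h (F y)) x =
  \sum_i 'D_v (fun y => F y 0 i) x * 'D_(delta_mx 0 i) h (F x).
Proof.
move=> dF dh; rewrite -[fun y => _]/(h \o F).
rewrite deriveE; last exact: differentiable_comp.
rewrite diff_comp// -[LHS]/('d h (F x) ('d F x v)) -(deriveE v dF).
rewrite {1}(row_sum_delta ('D_v F x)) linear_sum; apply: eq_bigr => i _.
by rewrite linearZ -(deriveE _ dh) derive_entry.
Qed.

Lemma Ck_comp {V : normedModType R} m k (A : set V) (B : set 'rV[R]_m)
    (h : 'rV[R]_m -> R) (F : V -> 'rV[R]_m) : open A ->
  (forall x, A x -> B (F x)) -> Ck k B h -> Ck k A F ->
  Ck k A (fun x => h (F x)).
Proof.
move=> oA AB; elim: k h => [|k ih] h Ch CF.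
  split=> // x Ax; apply: (differentiable_comp (g := h)).
    exact: (Ck_diff CF).
  by apply: (Ck_diff Ch); exact: AB.
split=> [x Ax|v].
  apply: (differentiable_comp (g := h)); first exact: (Ck_diff CF).
  by apply: (Ck_diff Ch); exact: AB.
have C : Ck k A (fun x =>
    \sum_i 'D_v (fun y => F y 0 i) x * 'D_(delta_mx 0 i) h (F x)).
  apply: Ck_sum => // i; apply: Ck_mul => //.
    by have /(_ 0 i)[_] := (Ck_mxP _ F oA).1 CF; apply.
  by apply: (ih (fun y => 'D_(delta_mx 0 i) h y)); [exact: Ch.2|exact: CkW].
apply: (Ck_eq oA _ C) => x Ax; rewrite derive_comp_coord//.
  exact: (Ck_diff CF).
by apply: (Ck_diff Ch); exact: AB.
Qed.

Lemma smooth_on_cst {V W : normedModType R} (A : set V) (a : W) :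
  smooth_on A (cst a).
Proof. by apply/smooth_onP => k; exact: Ck_cst. Qed.

Lemma smooth_on_mulmx {V : normedModType R} m n p (A : set V)
    (f : V -> 'M[R]_(m, n)) (g : V -> 'M[R]_(n, p)) : open A ->
  smooth_on A f -> smooth_on A g -> smooth_on A (fun x => f x *m g x).
Proof.
move=> oA /smooth_onP Cf /smooth_onP Cg; apply/smooth_onP => k.
apply/Ck_mxP => // i j; under eq_fun do rewrite mxE.
apply: Ck_sum => // l; apply: Ck_mul => //.
  exact: (Ck_mxP _ f oA).1.
exact: (Ck_mxP _ g oA).1.
Qed.

Lemma smooth_on_comp {V : normedModType R} m p q (A : set V)
    (B : set 'rV[R]_m) (h : 'rV[R]_m -> 'M[R]_(p, q)) (F : V -> 'rV[R]_m) :
  open A -> open B -> (forall x, A x -> B (F x)) ->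
  smooth_on B h -> smooth_on A F -> smooth_on A (fun x => h (F x)).
Proof.
move=> oA oB AB /smooth_onP Ch /smooth_onP CF; apply/smooth_onP => k.
apply/Ck_mxP => // i j; apply: (Ck_comp (h := fun y => h y i j)) AB _ _ => //.
exact: (Ck_mxP _ h oB).1.
Qed.

Lemma schwarz_mx {V : normedModType R} m n (A : set V)
    (f : V -> 'M[R]_(m, n)) x v w : open A -> smooth_on A f -> A x ->
  'D_v (fun y => 'D_w f y) x = 'D_w (fun y => 'D_v f y) x.
Proof.
move=> oA sf Ax; apply/matrixP => i j.
have dD u y : A y -> differentiable (fun y => 'D_u f y) y.
  by move=> Ay; exact: (smooth_on_diff (smooth_on_derive u sf)).
have E u y : A y -> 'D_u f y i j = 'D_u (fun y => f y i j) y.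
  by move=> Ay; rewrite derive_entry//; exact: (smooth_on_diff sf).
transitivity ('D_v (fun y => 'D_w f y i j) x).
  by apply/esym/derive_entry; exact: dD.
transitivity ('D_w (fun y => 'D_v f y i j) x); last first.
  by apply/derive_entry; exact: dD.
rewrite (derive_near_eq v oA (E w) Ax) (derive_near_eq w oA (E v) Ax).
apply: schwarz.
- near=> y; apply/differentiable_entry/(smooth_on_diff sf).
  by near: y; exact: open_nbhs_nbhs.
- apply: differentiable_near_eq (differentiable_entry i j (dD v x Ax)).
  by near=> y; apply: E; near: y; exact: open_nbhs_nbhs.
- apply: differentiable_near_eq (differentiable_entry i j (dD w x Ax)).
  by near=> y; apply: E; near: y; exact: open_nbhs_nbhs.
Unshelve. all: by end_near. Qed.

End SmoothCalculus.

(** * Bilinear forms given by matrices *)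

Section Inner.
Context {R : realType} {m : nat}.
Implicit Types (G H : 'M[R]_m) (u v w : 'rV[R]_m) (a : R).

Lemma innerDl G u v w : inner G (u + v) w = inner G u w + inner G v w.
Proof. by rewrite /inner !mulmxDl mxE. Qed.

Lemma innerDr G u v w : inner G w (u + v) = inner G w u + inner G w v.
Proof. by rewrite /inner linearD mulmxDr mxE. Qed.

Lemma innerZl G a v w : inner G (a *: v) w = a * inner G v w.
Proof. by rewrite /inner -!scalemxAl mxE. Qed.

Lemma innerZr G a v w : inner G v (a *: w) = a * inner G v w.
Proof. by rewrite /inner linearZ -scalemxAr mxE. Qed.

Lemma innerNl G v w : inner G (- v) w = - inner G v w.
Proof. by rewrite -scaleN1r innerZl mulN1r. Qed.

Lemma innerNr G v w : inner G v (- w) = - inner G v w.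
Proof. by rewrite -scaleN1r innerZr mulN1r. Qed.

Lemma innerBl G u v w : inner G (u - v) w = inner G u w - inner G v w.
Proof. by rewrite innerDl innerNl. Qed.

Lemma innerBr G u v w : inner G w (u - v) = inner G w u - inner G w v.
Proof. by rewrite innerDr innerNr. Qed.

Lemma inner0l G w : inner G 0 w = 0.
Proof. by rewrite /inner !mul0mx mxE. Qed.

Lemma inner0r G w : inner G w 0 = 0.
Proof. by rewrite /inner trmx0 mulmx0 mxE. Qed.

Lemma inner_mxP G H a v w : inner (a *: G + H) v w = a * inner G v w + inner H v w.
Proof. by rewrite /inner mulmxDr mulmxDl -scalemxAr -scalemxAl !mxE. Qed.

Lemma innerC G v w : G^T = G -> inner G v w = inner G w v.
Proof.
move=> GT; rewrite /inner.
have -> : (v *m G *m w^T) 0 0 = ((v *m G *m w^T)^T) 0 0 by rewrite [RHS]mxE.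
by rewrite !trmx_mul trmxK GT mulmxA.
Qed.

Lemma linear_form_sum (L : 'rV[R]_m -> R) (b : 'rV[R]_m) :
  (forall a u v, L (a *: u + v) = a * L u + L v) ->
  L b = \sum_k b 0 k * L (delta_mx 0 k).
Proof.
move=> LP.
have L0 : L 0 = 0 by have := LP (-1) 0 0; rewrite scaler0 addr0; lra.
rewrite {1}(row_sum_delta b).
elim/big_ind2 : _ => // [u x v y <- <-|k _].
  by have := LP 1 x y; rewrite scale1r mul1r.
by have := LP (b 0 k) (delta_mx 0 k) 0; rewrite L0 !addr0.
Qed.

Lemma pos_unitmx G : (forall v, v != 0 -> 0 < inner G v v) -> G \in unitmx.
Proof.
move=> Gpos; rewrite -row_free_unit -kermx_eq0; apply/negPn/negP => /rowV0Pn[v].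
move=> /sub_kermxP vG v0; have := Gpos v v0.
by rewrite /inner vG mul0mx mxE ltxx.
Qed.

End Inner.

Lemma innerE {R : realType} m (G : 'M[R]_m) v w :
  inner G v w = (v *m G *m w^T) 0 0.
Proof. by []. Qed.

(* Locked copies on matrix-valued functions: unification would otherwise unfold
   limits whenever it compares two distinct derivatives. *)
HB.lock Definition dmx {R : realType} {n p q} (f : 'rV[R]_n -> 'M[R]_(p, q))
  (v x : 'rV[R]_n) : 'M[R]_(p, q) := 'D_v f x.

HB.lock Definition gam {R : realType} {m} (g : 'rV[R]_m -> 'M[R]_m)
  (x v w : 'rV[R]_m) : 'rV[R]_m := christoffel g x v w.

Section Dmx.
Context {R : realType} {n : nat}.
Implicit Types (x v w : 'rV[R]_n) (a : R).

Lemma dmxE p q (f : 'rV[R]_n -> 'M[R]_(p, q)) v x : 'D_v f x = dmx f v x.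
Proof. by rewrite dmx.unlock. Qed.

Lemma gamE (g : 'rV[R]_n -> 'M[R]_n) x v w : christoffel g x v w = gam g x v w.
Proof. by rewrite gam.unlock. Qed.

Lemma dmx_linear p q (f : 'rV[R]_n -> 'M[R]_(p, q)) x a v w :
  differentiable f x -> dmx f (a *: v + w) x = a *: dmx f v x + dmx f w x.
Proof. by move=> df; rewrite dmx.unlock !deriveE// linearP. Qed.

Lemma dmx0 p q (f : 'rV[R]_n -> 'M[R]_(p, q)) x : dmx f 0 x = 0.
Proof. by rewrite dmx.unlock derive0. Qed.

Lemma dmx_cst p q (c : 'M[R]_(p, q)) v x : dmx (fun=> c) v x = 0.
Proof. by rewrite dmx.unlock; exact: derive_cst. Qed.

Lemma dmx_mul p q r (f : 'rV[R]_n -> 'M[R]_(p, q)) (g : 'rV[R]_n -> 'M[R]_(q, r))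
    v x : differentiable f x -> differentiable g x ->
  dmx (fun y => f y *m g y) v x = dmx f v x *m g x + f x *m dmx g v x.
Proof. by move=> df dg; rewrite -!dmxE derive_mulmx. Qed.

Lemma dmx_tr p q (f : 'rV[R]_n -> 'M[R]_(p, q)) v x : differentiable f x ->
  dmx (fun y => (f y)^T) v x = (dmx f v x)^T.
Proof. by move=> df; rewrite -!dmxE derive_trmx. Qed.

Lemma dmxD p q (f g : 'rV[R]_n -> 'M[R]_(p, q)) v x :
  differentiable f x -> differentiable g x ->
  dmx (fun y => f y + g y) v x = dmx f v x + dmx g v x.
Proof.
move=> df dg; rewrite -!dmxE; apply: (deriveD (f := f) (g := g)).
  exact: diff_derivable.
exact: diff_derivable.
Qed.

Lemma dmx_sum p q (I : Type) (r : seq I) (f : I -> 'rV[R]_n -> 'M[R]_(p, q)) v x :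
  (forall i, differentiable (f i) x) ->
  dmx (fun y => \sum_(i <- r) f i y) v x = \sum_(i <- r) dmx (f i) v x.
Proof.
move=> df; rewrite -dmxE derive_fun_sum => [|i _]; last exact: df.
by apply: eq_bigr => i _; rewrite dmxE.
Qed.

Lemma dmx_eq p q (f g : 'rV[R]_n -> 'M[R]_(p, q)) (A : set 'rV[R]_n) v x :
  open A -> (forall y, A y -> f y = g y) -> A x -> dmx f v x = dmx g v x.
Proof. by move=> oA fg Ax; rewrite -!dmxE; exact: (derive_near_eq v oA fg). Qed.

Lemma dmx_comp m p q (f : 'rV[R]_m -> 'M[R]_(p, q)) (F : 'rV[R]_n -> 'rV[R]_m)
    v x : differentiable F x -> differentiable f (F x) ->
  dmx (fun y => f (F y)) v x = dmx f (dmx F v x) (F x).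
Proof.
move=> dF df; rewrite dmx.unlock -[fun y => _]/(f \o F).
rewrite deriveE; last exact: differentiable_comp.
by rewrite diff_comp// (deriveE _ df) (deriveE _ dF).
Qed.

Lemma dmxC p q (A : set 'rV[R]_n) (f : 'rV[R]_n -> 'M[R]_(p, q)) x v w :
  open A -> smooth_on A f -> A x -> dmx (dmx f w) v x = dmx (dmx f v) w x.
Proof.
by move=> oA sf Ax; rewrite dmx.unlock; exact: schwarz_mx oA sf Ax.
Qed.

Lemma smooth_on_dmx p q (A : set 'rV[R]_n) (f : 'rV[R]_n -> 'M[R]_(p, q)) v :
  smooth_on A f -> smooth_on A (dmx f v).
Proof. by rewrite dmx.unlock; exact: smooth_on_derive. Qed.

End Dmx.

(** * Covariant derivatives along a map *)

Definition metric_on {R : realType} {m} (B : set 'rV[R]_m)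
    (g : 'rV[R]_m -> 'M[R]_m) : Prop :=
  [/\ open B, smooth_on B g, forall x, B x -> (g x)^T = g x
    & forall x v, B x -> v != 0 -> 0 < inner (g x) v v].

(** Used both for the immersion and for the identity of an ambient chart, so that the ambient
    calculus is the case F = id. *)
Definition map_on {R : realType} {n m} (A : set 'rV[R]_n) (B : set 'rV[R]_m)
    (F : 'rV[R]_n -> 'rV[R]_m) : Prop :=
  [/\ open A, smooth_on A F & forall u, A u -> B (F u)].

Section Christoffel.
Context {R : realType} {m : nat} (g : 'rV[R]_m -> 'M[R]_m) (B : set 'rV[R]_m).
Hypothesis gB : metric_on B g.
Implicit Types (x v w z a b : 'rV[R]_m).
Local Notation Gam := (gam g).

Let oB : open B. Proof. by case: gB. Qed.
Let gsmooth : smooth_on B g. Proof. by case: gB. Qed.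
Let gsym x : B x -> (g x)^T = g x. Proof. by case: gB => _ _ + _; exact. Qed.
Let gpos x v : B x -> v != 0 -> 0 < inner (g x) v v.
Proof. by case: gB => _ _ _; exact. Qed.

Let gdiff x : B x -> differentiable g x.
Proof. exact: smooth_on_diff. Qed.

Let gunit x : B x -> g x \in unitmx.
Proof. by move=> Bx; apply: pos_unitmx => v; exact: gpos. Qed.

Lemma gam_row x v w : Gam x v w =
  (\row_k (2^-1 * (inner (dmx g v x) w (delta_mx 0 k)
                 + inner (dmx g w x) v (delta_mx 0 k)
                 - inner (dmx g (delta_mx 0 k) x) v w))) *m invmx (g x).
Proof.
rewrite gam.unlock /christoffel; congr (_ *m _); apply/rowP => k.
by rewrite !mxE !dmxE.
Qed.

Lemma derive_metric_sym x v : B x -> (dmx g v x)^T = dmx g v x.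
Proof.
move=> Bx; rewrite -dmx_tr; last exact: gdiff.
exact: (dmx_eq v oB gsym Bx).
Qed.

Lemma gamC x v w : B x -> Gam x v w = Gam x w v.
Proof.
move=> Bx; rewrite !gam_row; congr (_ *m _); apply/rowP => k; rewrite !mxE.
rewrite [inner _ v w]innerC; last exact: derive_metric_sym.
by congr (_ * (_ - _)); rewrite addrC.
Qed.

Lemma gamPr x v (c : R) a b : B x ->
  Gam x v (c *: a + b) = c *: Gam x v a + Gam x v b.
Proof.
move=> Bx; rewrite !gam_row scalemxAl -mulmxDl; congr (_ *m _).
apply/rowP => k; rewrite !mxE dmx_linear; last exact: gdiff.
rewrite inner_mxP !innerDl !innerDr !innerZl !innerZr; ring.
Qed.

Lemma gamPl x v (c : R) a b : B x ->
  Gam x (c *: a + b) v = c *: Gam x a v + Gam x b v.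
Proof. by move=> Bx; rewrite ![Gam x _ v]gamC// gamPr. Qed.

(** The Koszul formula. For basis vectors [b] it is the definition once the metric cancels its
    inverse, and both sides are linear in [b]. *)
Lemma inner_gam x v w b : B x -> inner (g x) (Gam x v w) b =
  2^-1 * (inner (dmx g v x) w b + inner (dmx g w x) v b - inner (dmx g b x) v w).
Proof.
move=> Bx; rewrite innerE gam_row mulmxKV ?gunit// mxE.
pose L b := 2^-1 *
  (inner (dmx g v x) w b + inner (dmx g w x) v b - inner (dmx g b x) v w).
rewrite -[RHS]/(L b) (linear_form_sum b (L := L)) => [|c u1 u2].
  by apply: eq_bigr => k _; rewrite !mxE mulrC.
rewrite /L dmx_linear; last exact: gdiff.
rewrite inner_mxP !innerDr !innerZr; ring.
Qed.

(** In the two Koszul formulas, with [a] and [b] exchanged, the derivatives along [a] and [b] have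
    opposite signs and cancel. *)
Lemma gam_metric x y a b : B x ->
  inner (dmx g y x) a b = inner (g x) (Gam x y a) b + inner (g x) a (Gam x y b).
Proof.
move=> Bx; rewrite [inner (g x) a _]innerC ?gsym// !inner_gam//.
rewrite [inner _ b a]innerC ?derive_metric_sym//.
by field.
Qed.

(* the matrix of w |-> Gamma(e_i, w) *)
Definition conn (i : 'I_m) x : 'M[R]_m :=
  \matrix_(j, k) Gam x (delta_mx 0 i) (delta_mx 0 j) 0 k.

(** A bilinear map written with matrix products only, so that [dmx_mul] differentiates it;
    [a *m delta_mx i 0] is the i-th coefficient of [a] as a 1 x 1 matrix. *)
Definition tens (C : 'I_m -> 'M[R]_m) a b : 'rV[R]_m :=
  \sum_i (a *m delta_mx i (0 : 'I_1)) *m (b *m C i).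

Lemma gam_tens x a b : B x -> Gam x a b = tens (conn ^~ x) a b.
Proof.
move=> Bx; apply/rowP => k; rewrite summxE.
rewrite (linear_form_sum a (L := fun a => Gam x a b 0 k)) => [|c u1 u2]; last first.
  by rewrite gamPl// !mxE.
apply: eq_bigr => i _; rewrite [RHS]mxE big_ord1 [X in _ = _ * X]mxE.
congr (_ * _).
  rewrite mxE (bigD1 i)//= big1 => [|j ji]; first by rewrite mxE !eqxx mulr1 addr0.
  by rewrite mxE (negbTE ji) mulr0.
rewrite (linear_form_sum b (L := fun b => Gam x (delta_mx 0 i) b 0 k)) => [|c u1 u2].
  by apply: eq_bigr => j _; rewrite [conn _ _ _ _]mxE.
by rewrite gamPr// !mxE.
Qed.

Lemma differentiable_conn i x : B x -> differentiable (conn i) x.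
Proof.
move=> Bx; apply: differentiable_mx => j k; under eq_fun do rewrite mxE.
apply: differentiable_entry; under eq_fun do rewrite gam_row.
apply: differentiable_mulmx; last first.
  by apply: differentiable_invmx; [exact: gdiff|exact: gunit].
have dinner v a b : differentiable (fun y => inner (dmx g v y) a b) x.
  apply: differentiable_entry; apply: differentiable_mulmx.
    apply: differentiable_mulmx; first exact: differentiable_cst.
    exact: (smooth_on_diff (smooth_on_dmx v gsmooth)).
  exact: differentiable_cst.
apply: differentiable_mx => p q; under eq_fun do rewrite mxE.
apply: differentiableM; first exact: differentiable_cst.
apply: differentiableB => //.
exact: differentiableD.
Qed.

End Christoffel.

Section TensDerive.
Context {R : realType} {n m : nat}.

Lemma differentiable_tens (C : 'I_m -> 'rV[R]_n -> 'M[R]_m)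
    (a b : 'rV[R]_n -> 'rV[R]_m) u :
  (forall i, differentiable (C i) u) -> differentiable a u ->
  differentiable b u ->
  differentiable (fun y => tens (C ^~ y) (a y) (b y)) u.
Proof.
move=> dC da db; apply: differentiable_fun_sum => i _.
by apply: differentiable_mulmx; apply: differentiable_mulmx.
Qed.

Lemma dmx_tens (C : 'I_m -> 'rV[R]_n -> 'M[R]_m)
    (a b : 'rV[R]_n -> 'rV[R]_m) v u :
  (forall i, differentiable (C i) u) -> differentiable a u ->
  differentiable b u ->
  dmx (fun y => tens (C ^~ y) (a y) (b y)) v u =
  tens (C ^~ u) (dmx a v u) (b u) + tens (C ^~ u) (a u) (dmx b v u)
  + tens (fun i => dmx (C i) v u) (a u) (b u).
Proof.
move=> dC da db.
have dcst (i : 'I_m) : differentiable (fun=> delta_mx i (0 : 'I_1) : 'cV[R]_m) u.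
  exact: differentiable_cst.
have d1 i : differentiable (fun y => a y *m delta_mx i (0 : 'I_1)) u.
  by apply: differentiable_mulmx => //; exact: dcst.
have d2 i : differentiable (fun y => b y *m C i y) u.
  exact: differentiable_mulmx.
rewrite /tens dmx_sum => [|i]; last exact: differentiable_mulmx.
rewrite -!big_split; apply: eq_bigr => i _ /=.
rewrite dmx_mul// dmx_mul// dmx_mul// dmx_cst mulmx0 addr0 mulmxDr.
by rewrite addrA.
Qed.

End TensDerive.

Section Along.
Context {R : realType} {n m : nat} (g : 'rV[R]_m -> 'M[R]_m).
Context (B : set 'rV[R]_m) (A : set 'rV[R]_n) (F : 'rV[R]_n -> 'rV[R]_m).
Hypotheses (gB : metric_on B g) (FA : map_on A B F).
Implicit Types (u v w : 'rV[R]_n) (a b xi eta : 'rV[R]_n -> 'rV[R]_m).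
Local Notation Gam := (gam g).

Let oA : open A. Proof. by case: FA. Qed.
Let oB : open B. Proof. by case: gB. Qed.
Let sF : smooth_on A F. Proof. by case: FA. Qed.
Let FB u : A u -> B (F u). Proof. by case: FA => _ _; exact. Qed.
Let dF u : A u -> differentiable F u.
Proof. exact: smooth_on_diff. Qed.
Let dg x : B x -> differentiable g x.
Proof. by case: gB => _ sg _ _; exact: smooth_on_diff. Qed.
Let dconn i u : A u -> differentiable (fun y => conn g i (F y)) u.
Proof.
move=> Au; apply: (differentiable_comp (g := conn g i)); first exact: dF.
by apply: (differentiable_conn gB); exact: FB.
Qed.

Lemma gam_along u a b : A u ->
  (\forall y \near u, Gam (F y) (a y) (b y) = tens (conn g ^~ (F y)) (a y) (b y)).
Proof.
move=> Au; near=> y; apply: (gam_tens gB); apply: FB.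
by near: y; exact: open_nbhs_nbhs.
Unshelve. all: by end_near. Qed.

Lemma differentiable_gam u a b : A u -> differentiable a u ->
  differentiable b u -> differentiable (fun y => Gam (F y) (a y) (b y)) u.
Proof.
move=> Au da db.
apply: (@differentiable_near_eq _ _ _
  (fun y => tens (conn g ^~ (F y)) (a y) (b y))).
  by near=> y; apply/esym; near: y; exact: gam_along.
by apply: (differentiable_tens (C := fun i y => conn g i (F y))) => // i;
  exact: dconn.
Unshelve. all: by end_near. Qed.

Lemma dmx_gam_tens u v a b : A u -> differentiable a u -> differentiable b u ->
  dmx (fun y => Gam (F y) (a y) (b y)) v u =
  Gam (F u) (dmx a v u) (b u) + Gam (F u) (a u) (dmx b v u)
  + tens (fun i => dmx (conn g i) (dmx F v u) (F u)) (a u) (b u).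
Proof.
move=> Au da db.
rewrite (@dmx_eq _ _ _ _ _ (fun y => tens (conn g ^~ (F y)) (a y) (b y)) A)//.
  rewrite (dmx_tens (C := fun i y => conn g i (F y)))// => [|i]; last exact: dconn.
  rewrite !(gam_tens gB _ _ (FB Au)).
  have -> // : (fun i => dmx (fun y => conn g i (F y)) v u) =
    fun i => dmx (conn g i) (dmx F v u) (F u).
  apply/funext => i; apply: (dmx_comp v (dF Au)).
  by apply: (differentiable_conn gB); exact: FB.
by move=> y Ay; apply: (gam_tens gB); exact: FB.
Qed.

Definition cov v xi u : 'rV[R]_m :=
  dmx xi v u + Gam (F u) (dmx F v u) (xi u).

Lemma differentiable_cov v xi u : A u -> smooth_on A xi ->
  differentiable (cov v xi) u.
Proof.
move=> Au sxi; apply: differentiableD.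
  exact: (smooth_on_diff (smooth_on_dmx v sxi)).
apply: differentiable_gam => //.
  exact: (smooth_on_diff (smooth_on_dmx v sF)).
exact: (smooth_on_diff sxi).
Qed.

(* The inner product as a 1 x 1 matrix, so that [dmx] applies to it. *)
Definition prodR xi eta u : 'M[R]_1 := xi u *m g (F u) *m (eta u)^T.

Lemma prodRE xi eta u : prodR xi eta u 0 0 = inner (g (F u)) (xi u) (eta u).
Proof. by rewrite innerE. Qed.

Lemma metric_compat u v xi eta : A u -> differentiable xi u ->
  differentiable eta u -> dmx (prodR xi eta) v u 0 0 =
  inner (g (F u)) (cov v xi u) (eta u) + inner (g (F u)) (xi u) (cov v eta u).
Proof.
move=> Au dxi deta.
have dgF : differentiable (fun y => g (F y)) u.
  by apply: (differentiable_comp (g := g)); [exact: dF|apply: dg; exact: FB].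
rewrite /prodR dmx_mul; last exact: differentiable_trmx.
- rewrite dmx_mul// (dmx_comp v (dF Au) (dg (FB Au))).
  rewrite dmx_tr// mulmxDl [LHS]mxE [X in X + _]mxE -!innerE.
  rewrite (gam_metric gB); last exact: FB.
  rewrite /cov !innerDl !innerDr; ring.
- exact: differentiable_mulmx.
Qed.

End Along.

(** * The curvature tensor in coordinates *)

Section Curvature.
Context {R : realType} {m : nat} (g : 'rV[R]_m -> 'M[R]_m) (B : set 'rV[R]_m).
Hypothesis gB : metric_on B g.
Local Notation Gam := (gam g).

(** R(v, w) z computed on constant extensions: the bracket term is absent and only Christoffel
    symbols are differentiated. *)
Definition curv (x v w z : 'rV[R]_m) : 'rV[R]_m :=
  dmx (fun y => Gam y w z) v x + Gam x v (Gam x w z)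
  - (dmx (fun y => Gam y v z) w x + Gam x w (Gam x v z)).

Lemma id_map_on : map_on B B id.
Proof.
case: gB => oB _ _ _; split=> //.
apply/smooth_onP; case => [|k]; split=> //.
move=> v; apply: (Ck_eq oB _ (Ck_cst k B v)) => x _.
by rewrite derive_id.
Qed.

Lemma dmx_id v x : dmx id v x = v :> 'rV[R]_m.
Proof. by rewrite -dmxE derive_id. Qed.

Lemma gam0l x w : B x -> Gam x 0 w = 0.
Proof.
move=> Bx; have := gamPl gB w (-1) 0 0 Bx.
by rewrite scaler0 addr0 scaleN1r addNr.
Qed.

Lemma curvatureE x v w z : B x ->
  curvature g (cst v) (cst w) (cst z) x = curv x v w z.
Proof.
move=> Bx.
have nablaE y (Y : 'rV[R]_m -> 'rV[R]_m) : nabla g (cst y) Y =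
    fun x => dmx Y y x + Gam x y (Y x).
  by apply/funext => x'; rewrite /nabla dmxE gamE.
have bracket0 : lie_bracket (cst v) (cst w) = cst 0.
  by apply/funext => x'; rewrite /lie_bracket !derive_cst subrr.
have nabla_cst y : nabla g (cst y) (cst z) = fun x => Gam x y z.
  by rewrite nablaE; apply/funext => x'; rewrite dmx_cst add0r.
by rewrite /curvature bracket0 !nabla_cst !nablaE gam0l// subr0.
Qed.

Lemma dmx_gam_cst x y a b : B x -> dmx (fun x => Gam x a b) y x =
  tens (fun i => dmx (conn g i) y x) a b.
Proof.
move=> Bx; have := @dmx_gam_tens _ _ _ g B B id gB id_map_on x y (cst a) (cst b) Bx.
rewrite !dmx_cst dmx_id gam0l// add0r => ->; try exact: differentiable_cst.
rewrite (gamC gB)// gam0l// add0r//.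
Qed.

End Curvature.

(** The curvature of the connection pulled back by [F] is the ambient curvature evaluated on F_* v
    and F_* w. No bracket appears because [v] and [w] are constant. *)
Lemma curv_along (R : realType) n m (g : 'rV[R]_m -> 'M[R]_m) B
    (A : set 'rV[R]_n) (F : 'rV[R]_n -> 'rV[R]_m) xi u v w :
  metric_on B g -> map_on A B F -> smooth_on A xi -> A u ->
  cov g F v (cov g F w xi) u - cov g F w (cov g F v xi) u =
  curv g (F u) (dmx F v u) (dmx F w u) (xi u).
Proof.
move=> gB FA sxi Au.
have [oA sF FB] := FA.
have dxi : differentiable xi u by exact: smooth_on_diff sxi Au.
have ddxi z : differentiable (dmx xi z) u.
  exact: (smooth_on_diff (smooth_on_dmx z sxi)).
have ddF z : differentiable (dmx F z) u.
  exact: (smooth_on_diff (smooth_on_dmx z sF)).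
have BF := FB _ Au.
(* The first group is symmetric in [y] and [z] by equality of mixed derivatives of [xi] and [F], the
   second visibly so. The third is one half of [curv]. *)
have E y z : cov g F y (cov g F z xi) u =
    dmx (dmx xi z) y u + gam g (F u) (dmx (dmx F z) y u) (xi u)
    + (gam g (F u) (dmx F z u) (dmx xi y u)
    + gam g (F u) (dmx F y u) (dmx xi z u))
    + (dmx (fun x => gam g x (dmx F z u) (xi u)) (dmx F y u) (F u)
    + gam g (F u) (dmx F y u) (gam g (F u) (dmx F z u) (xi u))).
  rewrite {1}/cov dmxD//; last exact: (differentiable_gam gB FA).
  rewrite (dmx_gam_tens gB FA)// -(dmx_gam_cst gB)//.
  have := gamPr gB (dmx F y u) 1 (dmx xi z u) (gam g (F u) (dmx F z u) (xi u)) BF.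
  rewrite !scale1r /cov => ->.
  rewrite -!addrA; do 2 congr (_ + _); congr (_ + _).
  by rewrite addrCA.
rewrite !E (dmxC v w oA sxi Au) (dmxC v w oA sF Au).
rewrite [gam g (F u) (dmx F w u) (dmx xi v u) + _]addrC.
by rewrite /curv opprD addrACA subrr add0r.
Qed.

(** * Symmetries of the curvature *)

Section CurvatureSymmetries.
Context {R : realType} {m : nat} (g : 'rV[R]_m -> 'M[R]_m) (B : set 'rV[R]_m).
Hypothesis gB : metric_on B g.
Local Notation Gam := (gam g).
Implicit Types (x y v w z : 'rV[R]_m).

Let dgam_diff x a b : B x -> differentiable (fun y => Gam y a b) x.
Proof.
move=> Bx; exact: (differentiable_gam gB (id_map_on gB) (a := cst a) (b := cst b)).
Qed.

Lemma curvN x v w z : curv g x w v z = - curv g x v w z.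
Proof. by rewrite /curv opprB. Qed.

Lemma curv_bianchi x v w z : B x ->
  curv g x v w z + curv g x w z v + curv g x z v w = 0.
Proof.
move=> Bx; have [oB _ _ _] := gB.
have D a b c : dmx (fun y => Gam y a b) c x = dmx (fun y => Gam y b a) c x.
  by apply: (dmx_eq c oB _ Bx) => y By; rewrite (gamC gB).
rewrite /curv [dmx (fun y => Gam y z v) w x]D [dmx (fun y => Gam y w v) z x]D.
rewrite [dmx (fun y => Gam y z w) v x]D.
rewrite (gamC gB z v Bx) (gamC gB w v Bx) (gamC gB z w Bx).
by apply/rowP => k; rewrite !mxE; ring.
Qed.

Lemma curvD1 x v v' w z : B x ->
  curv g x (v + v') w z = curv g x v w z + curv g x v' w z.
Proof.
move=> Bx; rewrite /curv.
have := dmx_linear 1 v v' (dgam_diff w z Bx); rewrite !scale1r => ->.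
have := gamPl gB (Gam x w z) 1 v v' Bx; rewrite !scale1r => ->.
have := gamPl gB z 1 v v' Bx; rewrite !scale1r => ->.
have := gamPr gB w 1 (Gam x v z) (Gam x v' z) Bx; rewrite !scale1r => ->.
rewrite !(dmx_gam_cst gB _ _ _ Bx).
have tensDl (C : 'I_m -> 'M[R]_m) a b c : tens C (a + b) c = tens C a c + tens C b c.
  by rewrite /tens -big_split; apply: eq_bigr => i _; rewrite !mulmxDl.
rewrite tensDl; apply/rowP => k; rewrite !mxE; ring.
Qed.

Lemma curvD3 x v w z z' : B x ->
  curv g x v w (z + z') = curv g x v w z + curv g x v w z'.
Proof.
move=> Bx; rewrite /curv.
have gamDr a : Gam x a (z + z') = Gam x a z + Gam x a z'.
  by have := gamPr gB a 1 z z' Bx; rewrite !scale1r.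
have gamDr' a b c : Gam x a (b + c) = Gam x a b + Gam x a c.
  by have := gamPr gB a 1 b c Bx; rewrite !scale1r.
rewrite !gamDr !gamDr' !(dmx_gam_cst gB _ _ _ Bx).
have tensDr (C : 'I_m -> 'M[R]_m) a b c : tens C c (a + b) = tens C c a + tens C c b.
  by rewrite /tens -big_split; apply: eq_bigr => i _; rewrite mulmxDl mulmxDr.
rewrite !tensDr; apply/rowP => k; rewrite !mxE; ring.
Qed.

(** Second derivatives of the function <z, z>, for constant [z], commute. By metric compatibility
    their commutator along [v] and [w] is 2 <R(v, w) z, z>. *)
Lemma curv_skew x v w z : B x -> inner (g x) (curv g x v w z) z = 0.
Proof.
move=> Bx; have [oB sg _ _] := gB; have idB := id_map_on gB.
have sz : smooth_on B (cst z : 'rV[R]_m -> 'rV[R]_m) by exact: smooth_on_cst.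
have dz y : B y -> differentiable (cst z : 'rV[R]_m -> 'rV[R]_m) y.
  by move=> By; exact: smooth_on_diff sz By.
pose a y := cov g id y (cst z).
pose p := prodR g id (cst z) (cst z).
have da c y : B y -> differentiable (a c) y.
  by move=> By; exact: (differentiable_cov gB idB).
have sp : smooth_on B p.
  rewrite /p /prodR; apply: smooth_on_mulmx => //; last exact: (smooth_on_cst z^T).
  by apply: smooth_on_mulmx => //.
have dprod f h y : B y -> differentiable f y -> differentiable h y ->
    differentiable (prodR g id f h) y.
  move=> By df dh; apply: differentiable_mulmx; last exact: differentiable_trmx.
  apply: differentiable_mulmx => //; exact: (smooth_on_diff sg).
have dp c y : B y -> dmx p c y =
    prodR g id (a c) (cst z) y + prodR g id (cst z) (a c) y.
  move=> By; apply/matrixP => i j; rewrite !ord1 mxE.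
  by rewrite (metric_compat gB idB).
have ddp c d : dmx (dmx p c) d x 0 0 =
    inner (g x) (cov g id d (a c) x) z + inner (g x) (a c x) (a d x)
    + (inner (g x) (a d x) (a c x) + inner (g x) z (cov g id d (a c) x)).
  rewrite (dmx_eq d oB (dp c) Bx) dmxD.
  - rewrite mxE (metric_compat gB idB d Bx (da c x Bx) (dz x Bx)).
    by rewrite (metric_compat gB idB d Bx (dz x Bx) (da c x Bx)).
  - exact: (dprod _ _ x Bx (da c x Bx) (dz x Bx)).
  - exact: (dprod _ _ x Bx (dz x Bx) (da c x Bx)).
have := dmxC v w oB sp Bx => /matrixP/(_ 0 0); rewrite !ddp.
have -> : curv g x v w z = cov g id v (a w) x - cov g id w (a v) x.
  by rewrite (curv_along v w gB idB sz Bx) !dmx_id.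
have sym : (g x)^T = g x by case: gB => _ _ + _; exact.
rewrite innerBl [inner _ z (cov _ _ _ _ _)]innerC// [inner _ z (cov _ _ w _ _)]innerC//.
rewrite [inner _ (a w x) (a v x)]innerC//.
move: (inner (g x) (cov g id v (a w) x) z) (inner (g x) (cov g id w (a v) x) z)
  (inner (g x) (a v x) (a w x)) => p1 p2 p3; lra.
Qed.

End CurvatureSymmetries.

(** * Parallel complex structure and its commutation with the curvature *)

Definition kaehler_on {R : realType} {m} (B : set 'rV[R]_m)
    (g J : 'rV[R]_m -> 'M[R]_m) : Prop :=
  [/\ smooth_on B J, forall x, B x -> J x *m J x = - 1%:M,
    forall x v w, B x -> inner (g x) (v *m J x) (w *m J x) = inner (g x) v w
    & forall X Y, smooth_on B X -> smooth_on B Y -> forall x, B x ->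
      nabla g X (fun y => Y y *m J y) x = nabla g X Y x *m J x].

Section Parallel.
Context {R : realType} {n m : nat} (g J : 'rV[R]_m -> 'M[R]_m).
Context (B : set 'rV[R]_m) (A : set 'rV[R]_n) (F : 'rV[R]_n -> 'rV[R]_m).
Hypotheses (gB : metric_on B g) (JB : kaehler_on B g J) (FA : map_on A B F).
Local Notation Gam := (gam g).

(** Testing parallelism on constant fields yields a pointwise formula for the derivative of the
    matrix [J], which can then be composed with any map [F]. *)
Lemma dmx_cpx x y z : B x ->
  z *m dmx J y x = Gam x y z *m J x - Gam x y (z *m J x).
Proof.
move=> Bx; have [sJ _ _ par] := JB.
have := par _ _ (@smooth_on_cst R _ _ B y) (@smooth_on_cst R _ _ B z) x Bx.
rewrite /nabla derive_cst add0r !gamE dmxE dmx_mul.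
- by rewrite dmx_cst mul0mx add0r => <-; rewrite addrK.
- exact: differentiable_cst.
- exact: smooth_on_diff sJ Bx.
Qed.

Lemma cov_cpx v (xi : 'rV[R]_n -> 'rV[R]_m) u : A u -> differentiable xi u ->
  cov g F v (fun y => xi y *m J (F y)) u = cov g F v xi u *m J (F u).
Proof.
move=> Au dxi; have [oA sF FB] := FA; have [sJ _ _ _] := JB.
have dF : differentiable F u by exact: smooth_on_diff sF Au.
have dJ : differentiable J (F u) by exact: smooth_on_diff sJ (FB _ Au).
rewrite /cov dmx_mul//; last exact: (differentiable_comp (g := J)).
rewrite (dmx_comp v dF dJ) dmx_cpx; last exact: FB.
by rewrite mulmxDl addrA subrK.
Qed.

Lemma cov_eq v (xi eta : 'rV[R]_n -> 'rV[R]_m) u : A u ->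
  (forall y, A y -> xi y = eta y) -> cov g F v xi u = cov g F v eta u.
Proof.
move=> Au xe; have [oA _ _] := FA.
by rewrite /cov (dmx_eq v oA xe Au) xe.
Qed.

Lemma smooth_cpx (xi : 'rV[R]_n -> 'rV[R]_m) : smooth_on A xi ->
  smooth_on A (fun y => xi y *m J (F y)).
Proof.
move=> sxi; have [oA sF FB] := FA; have [sJ _ _ _] := JB; have [oB _ _ _] := gB.
by apply: smooth_on_mulmx => //; exact: (smooth_on_comp oA oB FB).
Qed.

(** [J] commutes with each covariant derivative along [F], hence with their commutator. *)
Lemma curv_cpx_along (xi : 'rV[R]_n -> 'rV[R]_m) v w u : A u -> smooth_on A xi ->
  curv g (F u) (dmx F v u) (dmx F w u) (xi u *m J (F u)) =
  curv g (F u) (dmx F v u) (dmx F w u) (xi u) *m J (F u).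
Proof.
move=> Au sxi; have [oA _ _] := FA.
have -> := esym (curv_along v w gB FA (smooth_cpx sxi) Au).
have E a b : cov g F a (cov g F b (fun y => xi y *m J (F y))) u =
    cov g F a (cov g F b xi) u *m J (F u).
  rewrite -cov_cpx//; last exact: (differentiable_cov gB FA).
  apply: cov_eq => // y Ay; apply: cov_cpx => //; exact: smooth_on_diff sxi Ay.
by rewrite !E -mulmxBl (curv_along v w gB FA).
Qed.

End Parallel.

Lemma curv_cpx {R : realType} {m} (g J : 'rV[R]_m -> 'M[R]_m) (B : set 'rV[R]_m)
    x v w z : metric_on B g -> kaehler_on B g J -> B x ->
  curv g x v w (z *m J x) = curv g x v w z *m J x.
Proof.
move=> gB JB Bx.
have := curv_cpx_along gB JB (id_map_on gB) v w Bx (@smooth_on_cst R _ _ B z).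
by rewrite !dmx_id.
Qed.

(** * Algebra of Kaehler curvature tensors *)

Section KaehlerCurvature.
Context {R : realFieldType} {V : lmodType R}.
Variables (J : V -> V) (K : V -> V -> V -> V -> R).
Hypotheses (JD : forall x y, J (x + y) = J x + J y) (JJ : forall x, J (J x) = - x).
Hypotheses (KD1 : forall x x' y z w, K (x + x') y z w = K x y z w + K x' y z w)
  (KD3 : forall x y z z' w, K x y (z + z') w = K x y z w + K x y z' w)
  (KD4 : forall x y z w w', K x y z (w + w') = K x y z w + K x y z w').
Hypotheses (K12 : forall x y z w, K y x z w = - K x y z w)
  (K34 : forall x y z w, K x y w z = - K x y z w)
  (bianchi : forall x y z w, K x y z w + K y z x w + K z x y w = 0)
  (KJ : forall x y z w, K x y (J z) (J w) = K x y z w).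

Let KD2 x y y' z w : K x (y + y') z w = K x y z w + K x y' z w.
Proof. by rewrite K12 KD1 opprD -!K12. Qed.

Let K0 y z w : K 0 y z w = 0.
Proof. by have := KD1 0 0 y z w; rewrite addr0 => /eqP; rewrite eq_sym
  -subr_eq0 addrK => /eqP. Qed.

Let KN1 x y z w : K (- x) y z w = - K x y z w.
Proof. by apply/eqP; rewrite -addr_eq0 -KD1 addNr K0. Qed.

Let KN2 x y z w : K x (- y) z w = - K x y z w.
Proof. by rewrite K12 KN1 K12 opprK. Qed.

(** The classical octahedron argument: the four cyclic Bianchi identities, combined with both skew
    symmetries, form a linear system that forces the equality. *)
Lemma curvature_pair x y z w : K x y z w = K z w x y.
Proof.
have := bianchi x y z w; have := bianchi y z w x; have := bianchi z w x y.
have := bianchi w x y z.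
have := (K34 x y z w, K34 z w x y, K34 y z x w, K34 w x y z, K34 y w z x).
have := (K12 y w z x, K34 x z y w, K12 z x y w, K12 x w y z, K34 x w y z).
move=> [[[[h1 h2] h3] h4] h5] [[[[h6 h7] h8] h9] h10]; lra.
Qed.

Let KN3 x y z w : K x y (- z) w = - K x y z w.
Proof. by rewrite curvature_pair KN1 curvature_pair. Qed.

Let KN4 x y z w : K x y z (- w) = - K x y z w.
Proof. by rewrite curvature_pair KN2 curvature_pair. Qed.

Let KJ12 x y z w : K (J x) (J y) z w = K x y z w.
Proof. by rewrite curvature_pair KJ curvature_pair. Qed.

Let JN x : J (- x) = - J x.
Proof. have J0 : J 0 = 0 by apply: (addrI (J 0)); rewrite -JD !addr0.
by apply/eqP; rewrite -addr_eq0 -JD addNr J0. Qed.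

(** Put S = K(x, y, y, x) and Q = K(x, Jy, Jy, x). Then q(x + y) + q(x - y) = 2 q(x) + 2 q(y) + 4 S
    + 12 Q. Replacing y by Jy exchanges S and Q, so three times the new sum minus the old one
    eliminates Q and leaves 36 - 4 = 32 times S. *)
Lemma holomorphic_polarization x y (q := fun v => K v (J v) (J v) v) :
  32 * K x y y x = 3 * q (x + J y) + 3 * q (x - J y) - q (x + y) - q (x - y)
    - 4 * q x - 4 * q y.
Proof.
have e1 : K y (J y) (J x) x = K x (J x) (J y) y.
  by rewrite curvature_pair K12 K34 opprK.
have e2 : K y (J x) (J y) x = K x (J y) (J y) x.
  by rewrite -KJ12 JJ KN2 -K12 -[LHS]KJ JJ KN3 -[in RHS]KJ JJ KN3.
have e3 : K y (J x) (J x) y = K x (J y) (J y) x.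
  by rewrite -KJ12 -KJ JJ KN2 KN3 opprK K12 K34 opprK.
have e4 : K x (J y) (J x) y = K x (J y) (J y) x.
  by rewrite -KJ JJ KN3 -K34.
have e5 : K (J y) y (J x) x = - K x (J x) (J y) y.
  by rewrite K12 e1.
have e6 : K (J y) (J x) y x = - K x y y x.
  by rewrite KJ12 K12.
have e7 : K (J y) (J x) (J x) (J y) = K x y y x.
  by rewrite KJ12 KJ K12 K34 opprK.
have e8 : K x y (J x) (J y) = - K x y y x.
  by rewrite KJ K34.
have e9 : K x (J x) y (J y) = - K x (J x) (J y) y.
  by rewrite K34.
have e10 : K (J y) y y (J y) = q y.
  by rewrite /q K12 K34 opprK.
(* The only relation that uses Bianchi; it removes the remaining mixed term K(x, Jx, Jy, y). *)
have e11 : K x (J x) (J y) y = K x y y x + K x (J y) (J y) x.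
  have := bianchi x (J x) (J y) y.
  by rewrite KJ12 [K x y x y]K34 [K (J y) x _ _]K12 e4; lra.
rewrite /q !(JD, JN, JJ, KD1, KD2, KD3, KD4, KN1, KN2, KN3, KN4).
rewrite -/(q x) -/(q y).
rewrite ?(e1, e2, e3, e4, e5, e6, e7, e8, e9, e10) e11.
lra.
Qed.

End KaehlerCurvature.

(** * The Ricci equation *)

Section Ricci.
Context {R : realType} {n m : nat} (g J : 'rV[R]_m -> 'M[R]_m).
Context (B : set 'rV[R]_m) (A : set 'rV[R]_n) (F : 'rV[R]_n -> 'rV[R]_m).
Hypotheses (gB : metric_on B g) (JB : kaehler_on B g J) (FA : map_on A B F).
Hypothesis (Finj : forall u, A u -> injective ('d F u)).
Hypothesis (Freal : forall u v, A u -> is_normal g F u ('d F u v *m J (F u))).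
Hypothesis (Fumb : forall u v w, A u -> second_fundamental_form g F u v w =
  inner (induced_metric g F u) v w *: mean_curvature g F u).
Hypothesis (Fflat : forall X Y xi, smooth_on A X -> smooth_on A Y ->
  smooth_on A xi -> (forall u, A u -> is_normal g F u (xi u)) ->
  forall u, A u -> normal_curvature g F X Y xi u = 0).
Implicit Types (u v w z : 'rV[R]_n) (y eta : 'rV[R]_m).
Local Notation gF u := (inner (g (F u))).
Local Notation G u := (induced_metric g F u).

Let oA : open A. Proof. by case: FA. Qed.
Let sF : smooth_on A F. Proof. by case: FA. Qed.
Let FB u : A u -> B (F u). Proof. by case: FA => _ _; exact. Qed.
Let dF u : A u -> differentiable F u.
Proof. exact: smooth_on_diff. Qed.
Let gsym u : A u -> (g (F u))^T = g (F u).
Proof. by case: gB => _ _ gs _ Au; apply: gs; exact: FB. Qed.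

Lemma diff_dmx u v : A u -> 'd F u v = dmx F v u.
Proof. by move=> Au; rewrite -dmxE (deriveE v (dF Au)). Qed.

Lemma mul_jacobian u v : A u -> v *m 'J F u = dmx F v u.
Proof. by move=> Au; rewrite -dmxE (deriveEjacobian v (dF Au)). Qed.

Lemma inner_induced u v w : A u -> inner (G u) v w = gF u (dmx F v u) (dmx F w u).
Proof.
by move=> Au; rewrite !innerE -!mul_jacobian// trmx_mul /induced_metric !mulmxA.
Qed.

Lemma induced_sym u : A u -> (G u)^T = G u.
Proof.
by move=> Au; rewrite /induced_metric trmx_mul trmx_mul trmxK (gsym Au) mulmxA.
Qed.

Lemma is_normalP u eta : A u ->
  is_normal g F u eta <-> forall v, gF u (dmx F v u) eta = 0.
Proof.
by move=> Au; split=> h v; have := h v; rewrite diff_dmx.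
Qed.

Lemma induced_pos u v : A u -> v != 0 -> 0 < inner (G u) v v.
Proof.
move=> Au v0; rewrite inner_induced//.
case: gB => _ _ _; apply; first exact: FB.
apply: contra_neq v0 => Fv0; apply: (Finj Au).
by rewrite linear0 diff_dmx.
Qed.

Lemma induced_unitmx u : A u -> G u \in unitmx.
Proof. by move=> Au; apply: pos_unitmx => v; exact: induced_pos. Qed.

Lemma tangent_partE u y : A u -> tangent_part g F u y =
  dmx F (y *m g (F u) *m ('J F u)^T *m invmx (G u)) u.
Proof. by move=> Au; rewrite -mul_jacobian. Qed.

Lemma inner_tangent_part u y eta : A u -> is_normal g F u eta ->
  gF u (tangent_part g F u y) eta = 0.
Proof. by move=> Au /(is_normalP _ Au) h; rewrite tangent_partE. Qed.

Lemma inner_normal_part u y eta : A u -> is_normal g F u eta ->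
  gF u (normal_part g F u y) eta = gF u y eta.
Proof. by move=> Au h; rewrite /normal_part innerBl inner_tangent_part// subr0. Qed.

(** The induced metric is invertible, so the pairings with tangent vectors determine the tangent
    part. *)
Lemma tangent_part_eq u y v : A u ->
  (forall z, gF u y (dmx F z u) = inner (G u) v z) ->
  tangent_part g F u y = dmx F v u.
Proof.
move=> Au h; rewrite tangent_partE//; congr (dmx F _ u).
suff -> : y *m g (F u) *m ('J F u)^T = v *m G u by rewrite mulmxK ?induced_unitmx.
apply/rowP => k; have := h (delta_mx 0 k).
rewrite !innerE -mul_jacobian// trmx_mul !mulmxA.
have entry (p : 'rV[R]_n) : (p *m (delta_mx 0 k)^T) 0 0 = p 0 k.
  rewrite mxE (bigD1 k)//= big1 => [|j jk]; rewrite !mxE ?eqxx ?mulr1 ?addr0//.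
  by rewrite (negbTE jk) andbF mulr0.
by rewrite !entry.
Qed.

Lemma nabla_along_cov v (xi : 'rV[R]_n -> 'rV[R]_m) u : A u ->
  nabla_along g F (cst v) xi u = cov g F v xi u.
Proof. by move=> Au; rewrite /nabla_along /cov dmxE gamE diff_dmx. Qed.

Lemma normal_part_sff u v w : A u ->
  normal_part g F u (cov g F v (dmx F w) u) =
  inner (G u) v w *: mean_curvature g F u.
Proof.
move=> Au; rewrite -Fumb// /second_fundamental_form nabla_along_cov//.
by congr normal_part; apply: (cov_eq g FA v Au) => t At; rewrite diff_dmx.
Qed.

(* the normal field J F_* z *)
Let xi z u := dmx F z u *m J (F u).
Let a z u := gF u (xi z u) (mean_curvature g F u).

Let sxi z : smooth_on A (xi z).
Proof. by apply: (smooth_cpx gB JB FA); exact: smooth_on_dmx. Qed.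

Let dxi z u : A u -> differentiable (xi z) u.
Proof. exact: smooth_on_diff. Qed.

Let ddF z u : A u -> differentiable (dmx F z) u.
Proof. by apply: smooth_on_diff; exact: smooth_on_dmx. Qed.

Let xi_normal z u : A u -> is_normal g F u (xi z u).
Proof. by move=> Au; rewrite /xi -diff_dmx//; exact: Freal. Qed.

Let normal_inner z v u : A u -> gF u (xi z u) (dmx F v u) = 0.
Proof.
move=> Au; rewrite innerC ?gsym//.
by have /is_normalP := xi_normal z Au; exact.
Qed.

Let normal_compat (eta1 eta2 : 'rV[R]_n -> 'rV[R]_m) v u : A u ->
  differentiable eta1 u -> differentiable eta2 u ->
  (forall t, A t -> gF t (eta1 t) (eta2 t) = 0) ->
  gF u (cov g F v eta1 u) (eta2 u) = - gF u (eta1 u) (cov g F v eta2 u).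
Proof.
move=> Au d1 d2 h; apply/eqP; rewrite -addr_eq0 -(metric_compat gB FA)//.
rewrite (dmx_eq (g := fun=> 0) v oA _ Au) ?dmx_cst ?mxE//.
by move=> y Ay; apply/matrixP => i j; rewrite !ord1 prodRE h// mxE.
Qed.

(** Differentiating <xi z, F_* w> = 0 shifts the derivative to F_* w, whose normal part is <v, w> H
    by umbilicity. Thus the shape operator of [xi z] is multiplication by [a z]. *)
Lemma weingarten z v w u : A u ->
  gF u (cov g F v (xi z) u) (dmx F w u) = - a z u * inner (G u) v w.
Proof.
move=> Au.
rewrite (normal_compat v Au (dxi z Au) (ddF w Au)) => [|y Ay]; last exact: normal_inner.
have -> : cov g F v (dmx F w) u =
    tangent_part g F u (cov g F v (dmx F w) u) +
    inner (G u) v w *: mean_curvature g F u.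
  by rewrite -normal_part_sff// /normal_part addrC subrK.
rewrite innerDr innerZr [gF u _ (tangent_part _ _ _ _)]innerC ?gsym//.
by rewrite (inner_tangent_part _ Au (xi_normal z Au)) add0r mulNr mulrC.
Qed.

(** Minus the tangent part of the ambient derivative of [xi z] along [w]; adding it produces the
    normal derivative. *)
Let theta z w u : 'rV[R]_m := a z u *: dmx F w u.

Let normal_nabla_xi z w u : A u ->
  normal_nabla g F (cst w) (xi z) u = cov g F w (xi z) u + theta z w u.
Proof.
move=> Au; rewrite /normal_nabla nabla_along_cov// /normal_part.
rewrite (@tangent_part_eq _ _ (- a z u *: w))//.
  have := dmx_linear (- a z u) w 0 (dF Au); rewrite !addr0 dmx0 addr0 => ->.
  by rewrite scaleNr opprK.
by move=> v; rewrite weingarten// innerZl.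
Qed.

(* [a z] is a quotient of differentiable functions by [weingarten]. *)
Let dtheta z w u : A u -> w != 0 -> differentiable (theta z w) u.
Proof.
move=> Au w0; apply: differentiable_mx => i j.
have dgF : differentiable (fun t => g (F t)) u.
  apply: (differentiable_comp (g := g)); first exact: dF.
  by case: gB => _ sg _ _; exact: smooth_on_diff sg (FB Au).
have dinner (e1 e2 : 'rV[R]_n -> 'rV[R]_m) :
    differentiable e1 u -> differentiable e2 u ->
    differentiable (fun t => gF t (e1 t) (e2 t)) u.
  move=> d1 d2; under eq_fun do rewrite innerE.
  apply: differentiable_entry; apply: differentiable_mulmx.
    exact: differentiable_mulmx.
  exact: differentiable_trmx.
apply: (@differentiable_near_eq _ _ _ (fun t =>
    - gF t (cov g F w (xi z) t) (dmx F w t) *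
      (gF t (dmx F w t) (dmx F w t))^-1 * dmx F w t i j)).
  near=> t.
  have At : A t by near: t; exact: open_nbhs_nbhs.
  rewrite /theta mxE weingarten// inner_induced// !mulNr opprK mulfK//.
  by rewrite -inner_induced// gt_eqF// induced_pos.
apply: differentiableM; last by apply: differentiable_entry; exact: ddF.
apply: differentiableM.
  apply: differentiableN; apply: dinner; last exact: ddF.
  exact: (differentiable_cov gB FA).
apply: differentiableV.
  by apply: dinner; exact: ddF.
by rewrite -inner_induced// gt_eqF// induced_pos.
Unshelve. all: by end_near. Qed.

Let covD v (e1 e2 : 'rV[R]_n -> 'rV[R]_m) u : A u ->
  differentiable e1 u -> differentiable e2 u ->
  cov g F v (fun t => e1 t + e2 t) u = cov g F v e1 u + cov g F v e2 u.
Proof.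
move=> Au d1 d2; rewrite /cov dmxD//.
have := gamPr gB (dmx F v u) 1 (e1 u) (e2 u) (FB Au); rewrite !scale1r => ->.
by rewrite addrACA.
Qed.

(** [theta z w] is tangent and [xi z'] normal, so the derivative of [theta z w] is traded for that
    of [xi z'], where [weingarten] applies again. The derivative of [a z] never appears. *)
Let second_normal z z' v w u : A u -> w != 0 ->
  gF u (normal_nabla g F (cst v) (normal_nabla g F (cst w) (xi z)) u) (xi z' u) =
  gF u (cov g F v (cov g F w (xi z)) u) (xi z' u) +
  a z u * a z' u * inner (G u) v w.
Proof.
move=> Au w0; rewrite {1}/normal_nabla inner_normal_part//; last exact: xi_normal.
rewrite nabla_along_cov// (cov_eq g FA v Au (normal_nabla_xi z w))//.
rewrite covD//; [|exact: (differentiable_cov gB FA)|exact: dtheta].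
rewrite innerDl; congr (_ + _).
rewrite (normal_compat v Au (dtheta z Au w0) (dxi z' Au)).
  rewrite /theta innerZl [gF u (dmx F w u) _]innerC ?gsym// weingarten//; ring.
move=> t At; rewrite /theta innerZl [gF t (dmx F w t) _]innerC ?gsym//.
by rewrite normal_inner// mulr0.
Qed.

(** The Ricci equation for the fields [xi z]: the umbilical terms of [second_normal] are symmetric
    in [v] and [w], so they cancel and vanishing normal curvature becomes vanishing ambient
    curvature. *)
Lemma flat_curv z z' v w u : A u -> v != 0 -> w != 0 ->
  gF u (curv g (F u) (dmx F v u) (dmx F w u) (xi z u)) (xi z' u) = 0.
Proof.
move=> Au v0 w0.
have := Fflat (@smooth_on_cst R _ _ A v) (@smooth_on_cst R _ _ A w) (sxi z)
  (xi_normal z) Au.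
rewrite /normal_curvature.
have -> : lie_bracket (cst v) (cst w) = cst 0 :> ('rV[R]_n -> 'rV[R]_n).
  by apply/funext => x; rewrite /lie_bracket !derive_cst subrr.
have -> : normal_nabla g F (cst 0) (xi z) u = 0.
  rewrite /normal_nabla nabla_along_cov// /cov !dmx0 (gam0l gB _ (FB Au)) addr0.
  by rewrite /normal_part tangent_partE// !mul0mx dmx0 subrr.
rewrite subr0 => /subr0_eq/(congr1 (fun t => gF u t (xi z' u))) flat.
have := etrans (esym (second_normal z z' v Au w0))
  (etrans flat (second_normal z z' w Au v0)).
rewrite [inner (G u) w v](innerC _ _ (induced_sym Au)).
rewrite -(curv_along v w gB FA (sxi z) Au) innerBl => /addIr ->.
by rewrite subrr.
Qed.

Lemma flat_sectional v w u : A u -> v != 0 -> w != 0 ->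
  gF u (curv g (F u) (dmx F v u) (dmx F w u) (dmx F w u)) (dmx F v u) = 0.
Proof.
move=> Au v0 w0; have := flat_curv w v Au v0 w0.
rewrite /xi (curv_cpx _ _ _ gB JB (FB Au)).
by case: JB => _ _ -> //; exact: FB.
Qed.

End Ricci.

(** * Complex space forms *)

Section SpaceForm.
Context {R : realType} {m : nat} (g J : 'rV[R]_m -> 'M[R]_m) (B : set 'rV[R]_m).
Hypotheses (gB : metric_on B g) (JB : kaehler_on B g J).
Variables (x : 'rV[R]_m) (c : R).
Hypothesis Bx : B x.
Hypothesis holo : forall v, v != 0 -> sectional_curvature g x v (v *m J x) = c.
Implicit Types v w z : 'rV[R]_m.

Let JJ v : v *m J x *m J x = - v.
Proof. by case: JB => _ JJ _ _; rewrite -mulmxA JJ// mulmxN mulmx1. Qed.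

Let Jiso v w : inner (g x) (v *m J x) (w *m J x) = inner (g x) v w.
Proof. by case: JB => _ _ + _; apply. Qed.

Let gC v w : inner (g x) v w = inner (g x) w v.
Proof. by apply: innerC; case: gB => _ _ + _; apply. Qed.

Lemma inner_cpx v w : inner (g x) (v *m J x) w = - inner (g x) v (w *m J x).
Proof. by rewrite -Jiso JJ innerNl. Qed.

Lemma inner_cpx_self v : inner (g x) v (v *m J x) = 0.
Proof.
have := inner_cpx v v; rewrite gC.
move: (inner _ _ _) => s; lra.
Qed.

Let K v w z t := inner (g x) (curv g x v w z) t.

(** [v] and J v are orthogonal of equal length, so the denominator of the sectional curvature is
    |v|^4. The zero vector is included because polarization evaluates at sums that may vanish. *)
Lemma holomorphic_curvature v :
  K v (v *m J x) (v *m J x) v = c * inner (g x) v v ^+ 2.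
Proof.
have [->|v0] := eqVneq v 0; first by rewrite /K !inner0r expr0n/= mulr0.
have vv : inner (g x) v v != 0.
  by rewrite gt_eqF//; case: gB => _ _ _; apply.
have := holo v0; rewrite /sectional_curvature (curvatureE gB)//.
rewrite inner_cpx_self Jiso expr0n/= subr0 -expr2 => <-.
by rewrite divfK// expf_neq0.
Qed.

(** With p = |v|^2, q = |w|^2 and r = <v, w>, the hypothesis gives |v ± Jw|^2 = p + q, while |v ±
    w|^2 = p + q ± 2r. Polarization then reads 32 K = 8 c (p q - r^2). *)
Lemma space_form_curvature v w : inner (g x) v (w *m J x) = 0 ->
  4 * K v w w v =
  c * (inner (g x) v v * inner (g x) w w - inner (g x) v w ^+ 2).
Proof.
move=> vJw.
have JD v1 v2 : (v1 + v2) *m J x = v1 *m J x + v2 *m J x by rewrite mulmxDl.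
have KD1 v1 v2 v3 v4 v5 : K (v1 + v2) v3 v4 v5 = K v1 v3 v4 v5 + K v2 v3 v4 v5.
  by rewrite /K (curvD1 gB)// innerDl.
have KD3 v1 v2 v3 v4 v5 : K v1 v2 (v3 + v4) v5 = K v1 v2 v3 v5 + K v1 v2 v4 v5.
  by rewrite /K (curvD3 gB)// innerDl.
have KD4 v1 v2 v3 v4 v5 : K v1 v2 v3 (v4 + v5) = K v1 v2 v3 v4 + K v1 v2 v3 v5.
  by rewrite /K innerDr.
have K12 v1 v2 v3 v4 : K v2 v1 v3 v4 = - K v1 v2 v3 v4.
  by rewrite /K curvN innerNl.
have K34 v1 v2 v3 v4 : K v1 v2 v4 v3 = - K v1 v2 v3 v4.
  apply/eqP; rewrite -addr_eq0; apply/eqP.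
  have := curv_skew gB v1 v2 (v3 + v4) Bx; rewrite -/(K _ _ _ _) KD3 !KD4.
  by rewrite /K !(curv_skew gB)// add0r addr0 addrC.
have bianchi v1 v2 v3 v4 : K v1 v2 v3 v4 + K v2 v3 v1 v4 + K v3 v1 v2 v4 = 0.
  by rewrite /K -!innerDl (curv_bianchi gB)// inner0l.
have KJ v1 v2 v3 v4 : K v1 v2 (v3 *m J x) (v4 *m J x) = K v1 v2 v3 v4.
  by rewrite /K (curv_cpx _ _ _ gB JB Bx) Jiso.
have := holomorphic_polarization (J := fun v => v *m J x) JD JJ KD1 KD3 KD4
  K12 K34 bianchi KJ v w.
rewrite /= !holomorphic_curvature.
have wJv : inner (g x) (w *m J x) v = 0 by rewrite gC.
rewrite !(innerDl, innerDr, innerNl, innerNr) Jiso vJw wJv [inner (g x) w v]gC.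
move: (K v w w v) (inner (g x) v v) (inner (g x) w w) (inner (g x) v w).
move=> k p q r h; nra.
Qed.

End SpaceForm.

(** * The contradiction on a tangent plane *)

Lemma strict_cauchy_schwarz {R : realType} {m} (G : 'M[R]_m) (v w : 'rV[R]_m) :
  G^T = G -> (forall z, z != 0 -> 0 < inner G z z) ->
  w != 0 -> (forall a b : R, b != 0 -> a *: w != b *: v) ->
  inner G v w ^+ 2 < inner G v v * inner G w w.
Proof.
move=> GT Gpos w0 free.
have w_gt0 := Gpos w w0.
have := Gpos (inner G w w *: v - inner G v w *: w).
rewrite subr_eq0 eq_sym (free _ _ (lt0r_neq0 w_gt0)) => /(_ isT).
rewrite !(innerBl, innerBr, innerZl, innerZr) (innerC w v GT).
(* The squared norm of |w|^2 v - <v, w> w is |w|^2 times the Gram determinant. *)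
move: (inner G v v) (inner G v w) (inner G w w) w_gt0 => p r q q0.
have -> : q * (q * p - r * r) - r * (q * r - r * q) = q * (p * q - r ^+ 2).
  by ring.
by rewrite pmulr_rgt0// subr_gt0.
Qed.

(** [param a] is arbitrary off the chart image, so nearby points must be kept in [coord_image a] as
    well as in the preimage of the open set under [param a]. *)
Lemma open_local_dom {R : realType} {n m} {M : manifold R n} {N : manifold R m}
    (f : M -> N) a b : continuous f -> open (local_dom f a b).
Proof.
move=> cf; rewrite openE => _ [x [ax bx] <-]; rewrite /interior.
have ia : coord_image a (Defs.coord a x) by exists x.
have oW : open (dom a `&` f @^-1` dom b).
  apply: openI; first exact: dom_open.
  by apply: open_comp => [y _|]; [exact: cf|exact: dom_open].
have nW : nbhs (Defs.coord a x) (param a @^-1` (dom a `&` f @^-1` dom b)).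
  apply: (param_continuous ia); rewrite coordK//.
  exact: open_nbhs_nbhs.
have nI : nbhs (Defs.coord a x) (coord_image a).
  by apply: open_nbhs_nbhs; split=> //; exact: coord_open.
near=> u.
have [y ay yu] : coord_image a u by near: u.
have : (dom a `&` f @^-1` dom b) (param a u) by near: u.
by rewrite -yu coordK// => Wy; exists y.
Unshelve. all: by end_near. Qed.

Theorem corollary3p2 (R : realType) (n p : nat) (c : R)
    (N : kaehler_manifold R (n + p)) (n_ge2 : (2 <= n)%N)
    (N_space_form : complex_space_form N c) (c_neq0 : c != 0) :
  ~ exists (M : manifold R n) (f : M -> N),
      [/\ [set: M] !=set0, immersion f, totally_real f,
          totally_umbilical f (kaehler_metric N)
        & flat_normal_connection f (kaehler_metric N)].
Proof.
move=> [M [f [[x0 _] [[cf sf] imm] real umb flat]]].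
(* The argument is local: one chart around a point and one around its image suffice. *)
have [a ax] := dom_cover x0.
have [b bx] := dom_cover (f x0).
pose A := local_dom f a b; pose B := coord_image b.
pose F := local_expr f a b.
pose g := kaehler_metric N b; pose J := @cpx R (n + p) N b.
pose u := Defs.coord a x0.
have Au : A u by exists x0.
have oA : open A by exact: open_local_dom.
have FB t : A t -> B (F t).
  by move=> [y [ay by_] <-]; exists (f y) => //; rewrite /F /local_expr/= coordK.
have gB : metric_on B g.
  split; [exact: coord_open|exact: metric_smooth|exact: Defs.metric_sym|].
  by move=> t v; exact: metric_pos.
have JB : kaehler_on B g J.
  split; [exact: cpx_smooth|exact: cpx_square| |].
    by move=> t v w; exact: cpx_isometry.
  by move=> X Y sX sY t Bt; exact: cpx_parallel.
have FA : map_on A B F by split=> //; exact: sf.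
have Finj t : A t -> injective ('d F t) by exact: imm.
have Freal t v : A t -> is_normal g F t ('d F t v *m J (F t)) by exact: real.
(* Dimension at least 2 provides two independent tangent directions. *)
pose i0 : 'I_n := Ordinal (ltnW n_ge2); pose i1 : 'I_n := Ordinal n_ge2.
pose v : 'rV[R]_n := delta_mx 0 i0; pose w : 'rV[R]_n := delta_mx 0 i1.
have v0 : v != 0.
  by apply/eqP => /rowP/(_ i0)/eqP; rewrite !mxE !eqxx oner_eq0.
have w0 : w != 0.
  by apply/eqP => /rowP/(_ i1)/eqP; rewrite !mxE !eqxx oner_eq0.
have K0 := flat_sectional gB JB FA Finj Freal (fun t v w At => umb a b t v w At)
  (fun X Y xi => flat a b A oA (@subset_refl _ _) X Y xi) Au v0 w0.
have orth : inner (g (F u)) (dmx F v u) (dmx F w u *m J (F u)) = 0.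
  by have := Freal u w Au v; rewrite !(diff_dmx FA).
have := space_form_curvature gB JB (FB u Au)
  (fun z z0 => N_space_form b (F u) z (FB u Au) z0) orth.
(* With zero curvature and nonzero [c], the Gram determinant of [v] and [w] in the induced metric
   must vanish, against their independence. *)
rewrite K0 mulr0 -!(inner_induced g FA _ _ Au) => /esym/eqP.
rewrite mulf_eq0 (negbTE c_neq0)/= subr_eq0 => /eqP cs.
have free s t : t != 0 -> s *: w != t *: v.
  move=> t0; apply/eqP => /rowP/(_ i0)/eqP.
  by rewrite !mxE !eqxx mulr0 mulr1 eq_sym (negbTE t0).
have := @strict_cauchy_schwarz R n (induced_metric g F u) v w
  (induced_sym gB FA Au) (fun z => induced_pos gB FA Finj Au) w0 free.
by rewrite cs ltxx.
Qed.
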